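(* Let $(M,\xi)$ be a closed cooriented contact manifold. The space $\mathcal{G}$ (resp. $\widetilde{\mathcal{G}}$) is orderable if and only if there exists a non-decreasing map $c:(\mathcal{G},\preceq)\to(\mathbb{R},\le)$ (resp. $c:(\widetilde{\mathcal{G}},\preceq)\to(\mathbb{R},\le)$) such that 1. $c(\mathrm{id})=0$, 2. $\psi\succeq\mathrm{id}$ and $\psi\ne\mathrm{id}$ implies $c(\psi)>0$.
   Context: All maps and manifolds are $C^\infty$; contact manifolds are connected and cooriented. $\mathcal{G}=\mathcal{G}(M)$ is the group of compactly supported contactomorphisms of $(M,\xi)$ isotopic to $\mathrm{id}$ through compactly supported contactomorphisms, with the $C^1$-topology; $\widetilde{\mathcal{G}}$ is its universal cover (homotopy classes rel endpoints of paths starting at $\mathrm{id}$, with timewise composition), and $\mathrm{id}\in\widetilde{\mathcal{G}}$ is the class of the constant path. A contact form $\alpha$ supports $\xi$ if $\ker\alpha=\xi$ and $\alpha$ respects the coorientation. The $\alpha$-contact Hamiltonian of a contact isotopy $(\varphi_t)$ generated by the time-dependent vector field $(X_t)$ is $H_t=\alpha(X_t)$. An isotopy in $\widetilde{\mathcal{G}}$ is a continuous path in $\widetilde{\mathcal{G}}$ whose projection to $\mathcal{G}$ is a (smooth) contact isotopy; its Hamiltonian is that of the projection. On $\mathcal{G}$ or $\widetilde{\mathcal{G}}$, $x\preceq y$ (also $y\succeq x$) means there is an isotopy in that space from $x$ to $y$ with non-negative Hamiltonian (for one, equivalently any, supporting $\alpha$). The space is orderable if $\preceq$ is antisymmetric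 (a partial order). A map $c$ is non-decreasing if $x\preceq y$ implies $c(x)\le c(y)$. *)

(* Defs.v *)
From HB Require Import structures.
From mathcomp Require Import all_boot all_order all_algebra.
From mathcomp Require Import all_classical all_reals all_analysis.

Set Implicit Arguments.
Unset Strict Implicit.
Unset Printing Implicit Defensive.

Import Order.TTheory GRing.Theory Num.Theory.
Import numFieldNormedType.Exports.

Local Open Scope classical_set_scope.
Local Open Scope ring_scope.

Section smooth_functions.
Context {R : realType}.

(* [U] is meant to be open and [V] finite-dimensional: being C^k.+1 is then
   being differentiable with C^k directional derivatives. *)
Fixpoint Ck (k : nat) (V W : normedModType R) (U : set V) (f : V -> W) : Prop :=
  match k with
  | 0 => forall x, U x -> {for x, continuous f}
  | k'.+1 => (forall x, U x -> differentiable f x) /\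
             (forall v, Ck k' U (fun x => 'D_v f x))
  end.

(* Smoothness on an arbitrary subset [A] means local existence of smooth
   extensions; it is used for open [A] and for [0, 1] times an open set. *)
Definition smooth_on (V W : normedModType R) (A : set V) (f : V -> W) : Prop :=
  forall a, A a -> exists (U : set V) (g : V -> W),
    [/\ open U, U a, forall k, Ck k U g & forall x, A x -> U x -> g x = f x].

Lemma Ck_snd (k : nat) (V1 V2 W : normedModType R) (U : set V2) (f : V2 -> W) :
  Ck k U f -> Ck k [set p : V1 * V2 | U p.2] (fun p => f p.2).
Proof.
elim: k f => [|k IH] f /=.
  move=> fU p Up; apply: (@continuous_comp _ _ _ snd f); first exact: cvg_snd.
  exact: fU.
move=> [df Df]; split.
  move=> p Up; apply: (@differentiable_comp _ _ _ _ snd f); last exact: df.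
  by apply: linear_differentiable => x; exact: cvg_snd.
by move=> v; exact: (IH (fun x => 'D_(v.2) f x) (Df v.2)).
Qed.

Lemma smooth_on_snd (V1 V2 W : normedModType R) (B : set V1) (A : set V2)
    (f : V2 -> W) :
  smooth_on A f -> smooth_on (B `*` A) (fun p => f p.2).
Proof.
move=> fA a [_ Aa]; have [U [g [oU Ua gU gf]]] := fA _ Aa.
exists [set p | U p.2], (fun p => g p.2); split => //.
- by apply: (@open_comp _ _ snd U) => // x _; exact: cvg_snd.
- by move=> k; exact: Ck_snd.
- by move=> x [_ Ax] Ux; exact: gf.
Qed.

End smooth_functions.

Section manifolds.
Context {R : realType}.

Record chart (d : nat) (M : topologicalType) := Chart {
  chart_dom : set M;
  chart_map : M -> 'rV[R]_d;
  chart_inv : 'rV[R]_d -> M;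
  chart_dom_open : open chart_dom;
  chart_img_open : open (chart_map @` chart_dom);
  chart_mapK : forall x, chart_dom x -> chart_inv (chart_map x) = x;
  chart_map_continuous : {within chart_dom, continuous chart_map};
  chart_inv_continuous : {within chart_map @` chart_dom, continuous chart_inv}
}.

Record manifold (d : nat) := Manifold {
  manifold_sort :> topologicalType;
  atlas : Type;
  chart_at : atlas -> chart d manifold_sort;
  atlas_cover : forall x, exists i, chart_dom (chart_at i) x;
  atlas_compatible : forall i j,
    smooth_on (chart_map (chart_at i) @`
                 (chart_dom (chart_at i) `&` chart_dom (chart_at j)))
              (chart_map (chart_at j) \o chart_inv (chart_at i));
  manifold_hausdorff : hausdorff_space manifold_sort;
  manifold_second_countable : @second_countable manifold_sort
}.

End manifolds.

Arguments manifold : clear implicits.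
Arguments chart : clear implicits.
Arguments atlas {R d} _.

Section calculus.
Context {R : realType} {d : nat} (M : manifold R d).

Definition dom (i : atlas M) : set M := chart_dom (chart_at i).
Definition loc (i : atlas M) : M -> 'rV[R]_d := chart_map (chart_at i).
Definition par (i : atlas M) : 'rV[R]_d -> M := chart_inv (chart_at i).

(* A tangent vector is the family of its coordinates in all the charts around
   [x]; the coordinates in the other charts are 0, so that [=] is the equality
   of tangent vectors. *)
Record tangent (x : M) := Tangent {
  tcoord :> atlas M -> 'rV[R]_d;
  tcoord_change : forall i j, dom i x -> dom j x ->
    tcoord j = 'd (loc j \o par i) (loc i x) (tcoord i);
  tcoord_out : forall i, ~ dom i x -> tcoord i = 0
}.

Definition smooth_map (f : M -> M) : Prop :=
  continuous f /\
  forall i j, smooth_on (loc i @` [set x | dom i x /\ dom j (f x)])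
                        (loc j \o f \o par i).

Definition diffeomorphism (f : M -> M) : Prop :=
  smooth_map f /\ exists g, [/\ smooth_map g, cancel f g & cancel g f].

(* [w] is the image of [v] under the differential of [f] at [x]. *)
Definition is_pushforward (f : M -> M) (x : M) (v : tangent x)
    (w : tangent (f x)) : Prop :=
  forall i j, dom i x -> dom j (f x) ->
    w j = 'd (loc j \o f \o par i) (loc i x) (v i).

(* Isotopies are parametrized by [0, 1]; what happens outside is irrelevant. *)
Definition smooth_isotopy (phi : R -> M -> M) : Prop :=
  {within `[0, 1] `*` setT, continuous (fun p : R * M => phi p.1 p.2)} /\
  forall i j,
    smooth_on [set p : R * 'rV[R]_d | [/\ p.1 \in `[0, 1],
                 (loc i @` dom i) p.2 & dom j (phi p.1 (par i p.2))]]
              (fun p => loc j (phi p.1 (par i p.2))).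

(* The isotopy [phi] is generated by the time-dependent vector field [X]:
   d/dt phi_t = X_t \o phi_t (with one-sided derivatives at times 0 and 1). *)
Definition generated_by (phi : R -> M -> M) (X : R -> forall x, tangent x) :
    Prop :=
  forall t x i, t \in `[0, 1] -> dom i (phi t x) ->
    (s - t)^-1 *: (loc i (phi s x) - loc i (phi t x))
      @[s --> within `[0, 1] t^'] --> X t (phi t x) i.

(* The 1-form [alpha] is [v |-> v *m a x] in every chart, with [a] smooth, and
   its exterior derivative, (u, w) |-> w *m 'D_u a - u *m 'D_w a, is
   nondegenerate on the hyperplane field ker alpha. *)
Definition contact_form (alpha : forall x : M, tangent x -> R) : Prop :=
  forall i, exists a : 'rV[R]_d -> 'cV[R]_d,
    [/\ smooth_on (loc i @` dom i) a,
        forall x (v : tangent x), dom i x ->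
          alpha x v = (v i *m a (loc i x)) 0 0 &
        forall p, (loc i @` dom i) p ->
          a p != 0 /\
          forall u : 'rV[R]_d, u != 0 -> u *m a p = 0 ->
            exists2 w : 'rV[R]_d, w *m a p = 0 &
              w *m 'D_u a p - u *m 'D_w a p != 0].

End calculus.

Section contact_manifolds.
Context {R : realType}.

(* The coorientation is recorded by the tangent vectors which are positively
   transverse to the hyperplane field [xi]. *)
Definition supports (d : nat) (M : manifold R d)
    (alpha : forall x : M, tangent x -> R)
    (xi positive : forall x : M, set (tangent x)) : Prop :=
  contact_form alpha /\
  forall x, xi x = [set v | alpha x v = 0] /\
            positive x = [set v | 0 < alpha x v].

(* Closed, connected and cooriented, of dimension 2n+1. *)
Record closed_contact_manifold (n : nat) := ClosedContactManifold {
  contact_base :> manifold R n.*2.+1;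
  contact_compact : compact [set: contact_base];
  contact_connected : connected [set: contact_base];
  xi : forall x : contact_base, set (tangent x);
  positive : forall x : contact_base, set (tangent x);
  contact_supported : exists alpha, supports alpha xi positive
}.

End contact_manifolds.

Arguments closed_contact_manifold : clear implicits.
Arguments xi {R n} M x _ : rename.
Arguments positive {R n} M x _ : rename.

Section contactomorphisms.
Context {R : realType} {n : nat} (M : closed_contact_manifold R n).

Definition contactomorphism (f : M -> M) : Prop :=
  diffeomorphism f /\
  forall x, xi M (f x) = [set w | exists2 v, xi M x v & is_pushforward v w].

Definition contact_isotopy (phi : R -> M -> M) : Prop :=
  smooth_isotopy phi /\ forall t, t \in `[0, 1] -> contactomorphism (phi t).

Definition contact_hamiltonian (alpha : forall x : M, tangent x -> R)
    (X : R -> forall x : M, tangent x) (t : R) (x : M) : R := alpha x (X t x).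

Definition nonneg_hamiltonian (phi : R -> M -> M) : Prop :=
  exists alpha X, [/\ supports alpha (xi M) (positive M),
    generated_by phi X &
    forall t x, t \in `[0, 1] -> 0 <= contact_hamiltonian alpha X t x].

Definition isotopic_to_id (f : M -> M) : Prop :=
  exists phi, [/\ contact_isotopy phi, phi 0 = id & phi 1 = f].

(* As M is closed, every contactomorphism is compactly supported. *)
Definition Gspace : Type :=
  {f : M -> M | contactomorphism f /\ isotopic_to_id f}.

Lemma pushforward_id (x : M) (v w : tangent x) :
  @is_pushforward _ _ M id x v w <-> v = w.
Proof.
split=> [vw|<-]; last by move=> i j ix jx; exact: tcoord_change.
have [i0 i0x] := atlas_cover x.
have E : tcoord v = tcoord w.
  apply/funext => j; have [jx|jx] := pselect (dom j x); last first.
    by rewrite !tcoord_out.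
  by rewrite (vw _ _ i0x jx) (tcoord_change v i0x jx).
case: v w E {vw} => v v1 v2 [w w1 w2] /= E.
by case: _ / E in w1 w2 *; congr Tangent; exact: Prop_irrelevance.
Qed.

Lemma smooth_map_id : @smooth_map _ _ M id.
Proof. by split=> [x|i j]; [exact: cvg_id|exact: atlas_compatible]. Qed.

Lemma contactomorphism_id : contactomorphism id.
Proof.
split; first by split; [|exists id; split=> //]; exact: smooth_map_id.
move=> x; apply/seteqP; split=> [w xw|w [v xv /pushforward_id <-]//].
by exists w => //; exact/pushforward_id.
Qed.

Lemma contact_isotopy_id : contact_isotopy (fun=> id).
Proof.
split; last by move=> t _; exact: contactomorphism_id.
split; first by apply: continuous_subspaceT => p; exact: cvg_snd.
move=> i j.
have := @smooth_on_snd _ R^o _ _ `[0, 1] _ _ (@atlas_compatible _ _ M i j).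
suff -> : `[0, 1] `*` (chart_map (chart_at i) @` (chart_dom (chart_at i)
      `&` chart_dom (chart_at j))) =
    [set p : R * 'rV[R]_(n.*2.+1) | [/\ p.1 \in `[0, 1],
      (loc i @` dom i) p.2 & dom j (par i p.2)]] by [].
apply/seteqP; split=> -[t p] /=.
  move=> [t01 [x [ix jx] <-]]; split=> //; first by exists x.
  by rewrite /par chart_mapK.
move=> [t01 [x ix <-]]; rewrite /par chart_mapK// => jx.
by split=> //; exists x.
Qed.

Lemma isotopic_id : contactomorphism id /\ isotopic_to_id id.
Proof.
by split; [exact: contactomorphism_id|exists (fun=> id); split=> //;
  exact: contact_isotopy_id].
Qed.

Definition idG : Gspace := exist _ id isotopic_id.

(* Subbasic neighbourhood of [f] in the C^1-topology: closeness over a compact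
   subset [K] of a chart, sent by [f] into a chart, of the values and of the
   first derivatives read in these charts. *)
Definition C1_nbhd (f : Gspace) (i j : atlas M) (K : set M) (e : R) :
    set Gspace :=
  [set g | forall x, K x ->
     [/\ dom j (sval g x),
         `|loc j (sval g x) - loc j (sval f x)| < e &
         exists2 e', e' < e & forall v : 'rV[R]_(n.*2.+1), `|v| <= 1 ->
           `|'d (loc j \o sval g \o par i) (loc i x) v -
             'd (loc j \o sval f \o par i) (loc i x) v| <= e']].

Definition C1_subbase : set (set Gspace) :=
  [set N | exists f i j K e,
     [/\ compact K, K `<=` dom i, K `<=` sval f @^-1` dom j, 0 < e &
         N = C1_nbhd f i j K e]].

HB.instance Definition _ := gen_eqMixin Gspace.
HB.instance Definition _ := gen_choiceMixin Gspace.
HB.instance Definition _ :=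
  @isSubBaseTopological.Build Gspace (set Gspace) C1_subbase id.

Definition Gisotopy (phi : R -> Gspace) : Prop :=
  contact_isotopy (fun t => sval (phi t)).

Definition Gle (x y : Gspace) : Prop :=
  exists phi : R -> Gspace, [/\ Gisotopy phi, phi 0 = x, phi 1 = y &
    nonneg_hamiltonian (fun t => sval (phi t))].

Definition Gpath (gamma : R -> Gspace) : Prop :=
  {within `[0, 1], continuous gamma}.

Definition path_homotopic (gamma delta : R -> Gspace) : Prop :=
  exists h : R * R -> Gspace,
    [/\ {within `[0, 1] `*` `[0, 1], continuous h},
        forall t, t \in `[0, 1] -> h (0, t) = gamma t,
        forall t, t \in `[0, 1] -> h (1, t) = delta t,
        forall s, s \in `[0, 1] -> h (s, 0) = gamma 0 &
        forall s, s \in `[0, 1] -> h (s, 1) = gamma 1].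

Definition path_class (gamma : R -> Gspace) : set (R -> Gspace) :=
  [set delta | path_homotopic gamma delta].

Definition Gcover : Type :=
  {C : set (R -> Gspace) |
    exists gamma, [/\ Gpath gamma, gamma 0 = idG & C = path_class gamma]}.

Lemma Gcover_id : exists gamma, [/\ Gpath gamma, gamma 0 = idG &
  path_class (fun=> idG) = path_class gamma].
Proof.
by exists (fun=> idG); split=> //; apply: continuous_subspaceT => t; exact: cvg_cst.
Qed.

Definition idGcover : Gcover := exist _ (path_class (fun=> idG)) Gcover_id.

(* The covering projection: evaluation at time 1 of a representative. *)
Definition cover_proj (C : Gcover) : Gspace := projT1 (cid (svalP C)) 1.

Definition path_concat (gamma eta : R -> Gspace) (t : R) : Gspace :=
  if t <= 2^-1 then gamma (2 * t) else eta (2 * t - 1).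

(* The usual topology of the universal cover is generated by the sets of the
   classes [gamma . eta], for [eta] a path in an open set [U] starting at the
   endpoint of [gamma]. *)
Definition cover_base : set (set Gcover) :=
  [set B | exists gamma U,
     [/\ Gpath gamma, gamma 0 = idG, open U &
         B = [set C | exists eta, [/\ Gpath eta, eta 0 = gamma 1,
                forall t, t \in `[0, 1] -> U (eta t) &
                sval C (path_concat gamma eta)]]]].

HB.instance Definition _ := gen_eqMixin Gcover.
HB.instance Definition _ := gen_choiceMixin Gcover.
HB.instance Definition _ :=
  @isSubBaseTopological.Build Gcover (set Gcover) cover_base id.

Definition Gcover_isotopy (x : R -> Gcover) : Prop :=
  {within `[0, 1], continuous x} /\ Gisotopy (cover_proj \o x).

Definition Gcover_le (x y : Gcover) : Prop :=
  exists z : R -> Gcover, [/\ Gcover_isotopy z, z 0 = x, z 1 = y &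
    nonneg_hamiltonian (fun t => sval (cover_proj (z t)))].

End contactomorphisms.

Definition orderable (T : Type) (le : T -> T -> Prop) : Prop :=
  forall x y, le x y -> le y x -> x = y.

Definition nondecreasing_map (R : realType) (T : Type) (le : T -> T -> Prop)
    (c : T -> R) : Prop :=
  forall x y, le x y -> c x <= c y.

(* Main.v *)
From HB Require Import structures.
Require Import Defs.
From mathcomp Require Import all_boot all_order all_algebra.
From mathcomp Require Import all_classical all_reals all_analysis.
From mathcomp Require Import sesquilinear finmap.
From mathcomp Require Import ring lra.

(** If the relation is transitive and antisymmetric, the indicator of the set
    of all psi different from id with id <= psi is non-decreasing, vanishes at id
    and is positive where it has to be ([orderable_exists_map]). Conversely, if a
    map c as in the theorem exists and x <= y <= x, then right multiplication by
    the inverse of x gives id <= psi <= id with psi the product of y and this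
    inverse; so c psi <= c id = 0, which forces psi = id, that is x = y
    ([exists_map_orderable]). What has to be proved is therefore that the
    relations are transitive and invariant under right translations.

    Transitivity ([Gle_trans], [Gcover_le_trans]) is concatenation of isotopies.
    To stay smooth at the junction each isotopy is first reparametrized by a
    smooth step, constant near both ends ([smooth_step]); this multiplies the
    generating field by the derivative of the step, which is non-negative. The
    sign of the Hamiltonian does not depend on the supporting form, since it says
    that the field is in the contact hyperplane or positively transverse to it
    ([supports_ge0]).

    Right translation by g maps an isotopy to one with the same generating field,
    hence the same Hamiltonian ([Gle_mul]); one needs that the contactomorphisms
    isotopic to the identity form a group ([isotopic_to_id_comp], [Gspace_inv]).

    In the universal cover, the right translation by the inverse of the class of
    gamma sends the class of delta to the class of
    (the reverse of gamma followed by delta) composed with the inverse of the end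
    of gamma ([translate]). It is injective, sends the class of gamma to id, and
    lifts a right translation of the group. It remains that it is continuous, so
    that it preserves isotopies ([Gcover_le_translate]); this follows from the
    continuity for the C^1-topology of the right translations of the group
    ([Gmul_continuous]), which is the chain rule together with compactness. *)

Set Implicit Arguments.
Unset Strict Implicit.
Unset Printing Implicit Defensive.

Import Order.TTheory GRing.Theory Num.Theory.
Import numFieldNormedType.Exports.

Local Open Scope classical_set_scope.
Local Open Scope ring_scope.

(** * Differential calculus of the classes C^k *)

Section differentiability.
Context {R : realType}.

Lemma near_eq_diff (V W : normedModType R) (f g : V -> W) (x : V) :
  (\forall y \near x, f y = g y) -> differentiable f x ->
  differentiable g x /\ 'd g x = 'd f x :> (V -> W).
Proof.
move=> fg df.
have E : g \o shift x = cst (g x) + 'd f x +o_ 0 id.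
  apply/eqaddoP => e e0.
  have /eqaddoP/(_ e e0) := diff_locally df.
  have fg0 : \forall h \near (0 : V), f (h + x) = g (h + x).
    by move: fg; rewrite (near_shift 0)/= subr0.
  apply: filter_app2 fg0; apply: nearW => h fgh.
  by rewrite /= !fctE /= fgh (nbhs_singleton fg).
have dc := diff_continuous df.
have dg : 'd g x = 'd f x :> (V -> W) by exact: diff_unique.
split=> //; apply/diff_locallyP; rewrite dg; split => //.
Qed.

Lemma near_eq_differentiable (V W : normedModType R) (f g : V -> W) (x : V) :
  (\forall y \near x, f y = g y) -> differentiable f x -> differentiable g x.
Proof. by move=> fg /(near_eq_diff fg)[]. Qed.

Lemma scale_is_bilinear (W : normedModType R) :
  bilinear_for
    (GRing.Scale.Law.clone _ _ *:%R _) (GRing.Scale.Law.clone _ _ *:%R _)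
    (@GRing.scale R W : R^o -> W -> W).
Proof.
split=> [u'|u] a x y /=; first by rewrite scalerDl scalerA.
by rewrite scalerDr !scalerA mulrC.
Qed.

Lemma diffZ_fun (V W : normedModType R) (a : V -> R) (f : V -> W) (x : V) :
  differentiable a x -> differentiable f x ->
  differentiable (fun y => a y *: f y) x /\
  forall v, 'd (fun y => a y *: f y) x v = a x *: 'd f x v + 'd a x v *: f x.
Proof.
move=> da df.
pose sM := bilinear_isBilinear.Build R R W W _ _ _ (scale_is_bilinear W).
pose S : {bilinear R^o -> W -> W} := HB.pack (@GRing.scale R W : R^o -> W -> W) sM.
have Sc : continuous (fun p : R^o * W => S p.1 p.2).
  by move=> p; exact: scale_continuous.
have dS := differentiable_bilin (f := S) (a x, f x) Sc.
have dp := differentiable_pair da df.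
have E : (fun y => a y *: f y) = (fun p : R^o * W => S p.1 p.2) \o (fun y => (a y, f y)) by [].
split; first by rewrite E; exact: differentiable_comp.
move=> v; rewrite E diff_comp//= (diff_bilin (f := S) (a x, f x) Sc) diff_pair//.
Qed.

End differentiability.

Section Ck_calculus.
Context {R : realType}.
Implicit Types V W : normedModType R.

Lemma Ck_subset k V W (U U' : set V) (f : V -> W) :
  U' `<=` U -> Ck k U f -> Ck k U' f.
Proof.
move=> sub; elim: k f => [|k IH] f /=; first by move=> + x /sub; exact.
by move=> [df Df]; split=> [x /sub|v]; [exact: df|exact: IH].
Qed.

Lemma Ck_pred k V W (U : set V) (f : V -> W) : Ck k.+1 U f -> Ck k U f.
Proof.
elim: k f => [|k IH] f /=.
  by move=> [df _] x Ux; exact/differentiable_continuous/df.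
by move=> [df Df]; split => // v; exact: IH.
Qed.

Lemma Ck_continuous k V W (U : set V) (f : V -> W) :
  Ck k U f -> forall x, U x -> {for x, continuous f}.
Proof. by elim: k => // k IH /Ck_pred/IH. Qed.

Lemma Ck_eq k V W (U : set V) (f g : V -> W) :
  open U -> (forall x, U x -> f x = g x) -> Ck k U f -> Ck k U g.
Proof.
move=> oU; elim: k f g => [|k IH] f g fg /=.
  move=> fc x Ux; rewrite /prop_for /continuous_at -fg//.
  apply: cvg_trans (fc _ Ux); apply: near_eq_cvg.
  by apply: filterS (open_nbhs_nbhs (conj oU Ux)) => y; exact: fg.
have nfg x : U x -> \forall y \near x, f y = g y.
  by move=> Ux; apply: filterS (open_nbhs_nbhs (conj oU Ux)) => y; exact: fg.
move=> [df Df]; split=> [x Ux|v].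
  by apply: near_eq_differentiable (df _ Ux); exact: nfg.
by apply: IH (Df v) => x Ux; apply: near_eq_derive; exact: nfg.
Qed.

Lemma Ck_cst k V W (U : set V) (c : W) : Ck k U (fun=> c).
Proof.
elim: k c => [|k IH] c /=; first by move=> x _; exact: cvg_cst.
split=> [x _|v]; first exact: differentiable_cst.
rewrite [X in Ck _ _ X](_ : _ = fun=> 0)//.
by apply/funext => x; rewrite derive_cst.
Qed.

Lemma CkD k V W (U : set V) (f g : V -> W) : open U ->
  Ck k U f -> Ck k U g -> Ck k U (fun x => f x + g x).
Proof.
move=> oU; elim: k f g => [|k IH] f g /=.
  by move=> fc gc x Ux; apply: continuousD; [exact: fc|exact: gc].
move=> [df Df] [dg Dg]; split=> [x Ux|v].
  by apply: differentiableD; [exact: df|exact: dg].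
apply: Ck_eq (IH _ _ (Df v) (Dg v)) => // x Ux.
by rewrite deriveD//; apply: diff_derivable; [exact: df|exact: dg].
Qed.

Lemma Ck_sum k V W (U : set V) (I : Type) (r : seq I) (f : I -> V -> W) :
  open U -> (forall i, Ck k U (f i)) -> Ck k U (fun x => \sum_(i <- r) f i x).
Proof.
move=> oU fC; elim: r => [|i r IH].
  by under eq_fun do rewrite big_nil; exact: Ck_cst.
by under eq_fun do rewrite big_cons; exact: CkD.
Qed.

Lemma Ck_linear k V W (U : set V) (L : {linear V -> W}) :
  continuous L -> Ck k U L.
Proof.
move=> Lc; case: k => [|k] /=; first by move=> x _; exact: Lc.
split=> [x _|v]; first exact: linear_differentiable.
rewrite [X in Ck _ _ X](_ : _ = fun=> L v); first exact: Ck_cst.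
apply/funext => x; rewrite deriveE; last exact: linear_differentiable.
by rewrite diff_lin.
Qed.

Lemma Ck_linear_comp k V V' W (U : set V) (f : V -> V') (L : {linear V' -> W}) :
  open U -> continuous L -> Ck k U f -> Ck k U (L \o f).
Proof.
move=> oU Lc; elim: k f => [|k IH] f /=.
  by move=> fc x Ux; apply: continuous_comp; [exact: fc|exact: Lc].
move=> [df Df].
have dL x : differentiable L x by exact: linear_differentiable.
split=> [x Ux|v]; first by apply: differentiable_comp; [exact: df|].
apply: Ck_eq (IH _ (Df v)) => // x Ux.
have dfx := df _ Ux; have dLf := differentiable_comp dfx (dL (f x)).
by rewrite /= !deriveE// (diff_comp dfx (dL (f x)))/= diff_lin.
Qed.

Lemma CkZ k V W (U : set V) (a : V -> R) (f : V -> W) : open U ->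
  Ck k U (a : V -> R^o) -> Ck k U f -> Ck k U (fun x => a x *: f x).
Proof.
move=> oU; elim: k a f => [|k IH] a f.
  by move=> ac fc x Ux; apply: continuousZ; [exact: ac|exact: fc].
move=> aC fC; have aC' := Ck_pred aC; have fC' := Ck_pred fC.
move: aC fC => [da Da] [df Df].
split=> [x Ux|v].
  by have [] := diffZ_fun (da _ Ux) (df _ Ux).
apply: Ck_eq (CkD oU (IH _ _ aC' (Df v)) (IH _ _ (Da v) fC')) => // x Ux.
have [d1 d2] := diffZ_fun (da _ Ux) (df _ Ux).
have ? := da _ Ux; have ? := df _ Ux.
by rewrite !deriveE.
Qed.

Lemma Ck_pair k V W W' (U : set V) (f : V -> W) (g : V -> W') : open U ->
  Ck k U f -> Ck k U g -> Ck k U (fun x => (f x, g x)).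
Proof.
move=> oU; elim: k f g => [|k IH] f g /=.
  by move=> fc gc x Ux; apply: cvg_pair; [exact: fc|exact: gc].
move=> [df Df] [dg Dg]; split=> [x Ux|v].
  by apply: differentiable_pair; [exact: df|exact: dg].
apply: Ck_eq (IH _ _ (Df v) (Dg v)) => // x Ux.
have dfx := df _ Ux; have dgx := dg _ Ux.
by rewrite !deriveE// ?diff_pair//; exact: differentiable_pair.
Qed.

(** Finite-dimensionality, in the form in which the chain rule uses it: a
    vector is a combination of finitely many fixed vectors, with coefficients
    which are continuous linear functions of it. *)
Definition has_coordinates V : Prop :=
  exists (I : Type) (r : seq I) (e : I -> V) (l : I -> {linear V -> R^o}),
    (forall i, continuous (l i)) /\ forall v, v = \sum_(i <- r) l i v *: e i.

(** By induction on k, expanding the differential of f in coordinates: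
    D_v (f o g) is a combination of the D_(e i) f o g, with coefficients the
    coordinates of D_v g. *)
Lemma Ck_comp k V V' W (U : set V) (U' : set V') (g : V -> V') (f : V' -> W) :
  has_coordinates V' -> open U -> (forall x, U x -> U' (g x)) ->
  Ck k U g -> Ck k U' f -> Ck k U (f \o g).
Proof.
move=> [I [r [e [l [lc le]]]]] oU gU; elim: k g f gU => [|k IH] g f gU.
  move=> gc fc x Ux; apply: continuous_comp; first exact: gc.
  exact/fc/gU.
move=> gC; have gC' := Ck_pred gC; move: gC => [dg Dg] [df Df].
split=> [x Ux|v].
  by apply: differentiable_comp; [exact: dg|exact/df/gU].
pose h x := \sum_(i <- r) l i ('D_v g x) *: 'D_(e i) f (g x).
apply: (@Ck_eq _ _ _ _ h) => //.
  move=> x Ux; have dgx := dg _ Ux; have dfx := df _ (gU _ Ux).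
  have dfg := differentiable_comp dgx dfx.
  rewrite /h !deriveE// (diff_comp dgx dfx)/= [in RHS](le ('d g x v)) linear_sum/=.
  by apply: eq_bigr => i _; rewrite deriveE// linearZ.
apply: Ck_sum => // i.
exact: CkZ oU (Ck_linear_comp oU (lc i) (Dg v)) (IH _ _ gU gC' (Df (e i))).
Qed.

Lemma has_coordinates_R : has_coordinates R^o.
Proof.
exists unit, [:: tt], (fun=> 1), (fun=> idfun); split; first by move=> _ x.
by move=> v; rewrite big_seq1 /= [RHS]mulr1.
Qed.

Lemma has_coordinates_rV d : has_coordinates 'rV[R]_d.
Proof.
pose c (i : 'I_d) (v : 'rV[R]_d) : R^o := v 0 i.
have cl i : linear (c i) by move=> a u v; rewrite /c !mxE.
pose cM i := GRing.isLinear.Build _ _ _ _ _ (cl i).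
pose cL i : {linear 'rV[R]_d -> R^o} := HB.pack (c i) (cM i).
exists 'I_d, (index_enum 'I_d), (fun i => delta_mx 0 i), cL; split.
  by move=> i; exact: coord_continuous.
by move=> v; rewrite [LHS]row_sum_delta.
Qed.

Lemma has_coordinates_prod V W :
  has_coordinates V -> has_coordinates W -> has_coordinates (V * W)%type.
Proof.
move=> [I [r [e [l [lc le]]]]] [J [s [f [m [mc mf]]]]].
have fl (i : I) : linear (fun p : V * W => l i p.1).
  by move=> a u v /=; rewrite linearP.
have sl (j : J) : linear (fun p : V * W => m j p.2).
  by move=> a u v /=; rewrite linearP.
pose fM i := GRing.isLinear.Build _ _ _ _ _ (fl i).
pose sM i := GRing.isLinear.Build _ _ _ _ _ (sl i).
pose fL i : {linear (V * W)%type -> R^o} := HB.pack (fun p : V * W => l i p.1) (fM i).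
pose sL i : {linear (V * W)%type -> R^o} := HB.pack (fun p : V * W => m i p.2) (sM i).
exists (I + J)%type, ([seq inl i | i <- r] ++ [seq inr j | j <- s]),
  (fun x => match x with inl i => (e i, 0) | inr j => (0, f j) end),
  (fun x => match x with inl i => fL i | inr j => sL j end); split.
  case=> [i|j] p; first by apply: continuous_comp; [exact: cvg_fst|exact: lc].
  by apply: continuous_comp; [exact: cvg_snd|exact: mc].
move=> [v w]; rewrite big_cat !big_map /=.
have -> : \sum_(i <- r) l i v *: (e i, 0 : W) = (v, 0).
  rewrite [in RHS](le v); elim: r {le} => [|i r IH]; first by rewrite !big_nil.
  by rewrite !big_cons IH; congr pair; rewrite /= scaler0 addr0.
have -> : \sum_(i <- s) m i w *: (0 : V, f i) = (0, w).
  rewrite [in RHS](mf w); elim: s {mf} => [|i s IH]; first by rewrite !big_nil.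
  by rewrite !big_cons IH; congr pair; rewrite /= scaler0 addr0.
by congr pair; rewrite /= ?addr0 ?add0r.
Qed.

End Ck_calculus.

(** * A smooth step function *)

Section smooth_step.
Context {R : realType}.

(** [flat 0] is the classical smooth function with zero Taylor series at 0; the
    factors t^-n are there because its derivatives are linear combinations of
    the [flat n]. *)
Definition flat (n : nat) (t : R) : R :=
  if 0 < t then t^-1 ^+ n * expR (- t^-1) else 0.

Lemma flat_pos n t : 0 < t -> flat n t = t^-1 ^+ n * expR (- t^-1).
Proof. by rewrite /flat => ->. Qed.

Lemma flat_neg n t : t <= 0 -> flat n t = 0.
Proof. by rewrite /flat leNgt => /negbTE ->. Qed.

Lemma flat_ge0 n t : 0 <= flat n t.
Proof.
rewrite /flat; case: ifPn => // t0.
by rewrite mulr_ge0 ?expR_ge0// exprn_ge0// invr_ge0 ltW.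
Qed.

Lemma flat_gt0 n t : 0 < t -> 0 < flat n t.
Proof. by move=> t0; rewrite flat_pos// mulr_gt0 ?expR_gt0// exprn_gt0// invr_gt0. Qed.

Lemma le_flat0 s t : s <= t -> flat 0 s <= flat 0 t.
Proof.
move=> st; have [s0|s0] := leP s 0; first by rewrite flat_neg// flat_ge0.
have t0 := lt_le_trans s0 st.
by rewrite !flat_pos// !expr0 !mul1r ler_expR lerN2 lef_pV2.
Qed.

(** With u = 1 / t this is the domination of powers by the exponential, in the
    form e^u = (e^(u / m))^m >= (u / m)^m for m = n + 2. It makes the
    difference quotients at 0 tend to 0. *)
Lemma flat_quadratic n : exists2 C : R, 0 <= C & forall t, `|flat n t| <= C * t ^+ 2.
Proof.
exists (n.+2%:R ^+ n.+2) => [|t]; first exact: exprn_ge0.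
have C0 : 0 <= (n.+2%:R : R) ^+ n.+2 by exact: exprn_ge0.
have [t0|t0] := leP t 0; first by rewrite flat_neg// normr0 mulr_ge0// sqr_ge0.
rewrite ger0_norm ?flat_ge0// flat_pos//; set u := t^-1.
have u0 : 0 < u by rewrite invr_gt0.
have m0 : 0 < (n.+2%:R : R) by [].
have E : (u / n.+2%:R) ^+ n.+2 <= expR u.
  have -> : expR u = expR (u / n.+2%:R) ^+ n.+2.
    by rewrite -expRM_natr divfK// gt_eqF.
  rewrite lerXn2r// ?nnegrE ?expR_ge0//; first by rewrite ltW// divr_gt0.
  by apply: le_trans (expR_ge1Dx _); rewrite lerDr.
rewrite expRN ler_pdivrMr ?expR_gt0//.
have -> : t = u^-1 by rewrite invrK.
have -> : u ^+ n = u ^+ n.+2 * u^-1 ^+ 2.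
  by rewrite -(addn2 n) exprD -mulrA -exprMn divff ?gt_eqF// expr1n mulr1.
rewrite [leRHS]mulrAC; apply: ler_wpM2r; first exact: sqr_ge0.
by move: E; rewrite expr_div_n ler_pdivrMr ?exprn_gt0// mulrC.
Qed.

Lemma is_derive_flat n (t : R) :
  is_derive t 1 (flat n) (flat n.+2 t - n%:R * flat n.+1 t).
Proof.
have [t0|t0|->] := ltgtP t 0.
- rewrite !flat_neg ?ltW// mulr0 subr0.
  apply: (@near_eq_is_derive _ _ _ (cst 0)).
  near=> s; rewrite flat_neg// ltW//.
  by near: s; exact: lt_nbhsl.
- have tn0 : t != 0 by rewrite gt_eqF.
  have dV : is_derive t (1 : R) (fun s : R => s^-1) (- t ^- 2).
    by apply: is_derive_eq; [exact: is_deriveV|rewrite [LHS]mulr1].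
  have dX := is_deriveX n dV.
  have dE := @is_derive1_comp _ expR (- (fun s : R => s^-1)) t _ _
    (is_derive_expR (- t^-1)) (is_deriveN dV).
  apply: (near_eq_is_derive _ (is_derive_eq (is_deriveM dX dE) _)).
    near=> s; rewrite !fctE flat_pos//.
    by near: s; exact: lt_nbhsr.
  rewrite !fctE !flat_pos// /GRing.scale/= opprK.
  case: n {dX} => [|n]; first by rewrite !mulr0n !mul0r subr0 mulr0 addr0 expr0 mul1r mulrC exprVn.
  rewrite -exprVn /=; move: (t^-1) => u.
  by rewrite !exprS expr0; move: (u ^+ n) (expR _) => w e; ring.
- rewrite !flat_neg// mulr0 subr0.
  have [C C0 qC] := flat_quadratic n.
  have C1 : 0 < C + 1 by rewrite ltr_wpDl.
  have D : h^-1 *: (flat n (h *: 1 + 0) - flat n 0) @[h --> (0 : R)^'] --> (0 : R).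
    apply/cvgr0Pnorm_le => e e0; near=> h.
    have hn0 : h != 0 by near: h; exact: nbhs_dnbhs_neq.
    rewrite addr0 [_ *: 1]mulr1 (@flat_neg n 0)// subr0 normrM normfV.
    rewrite ler_pdivrMl ?normr_gt0// (le_trans (qC h))//.
    rewrite -real_normK ?num_real// expr2 mulrCA ler_wpM2l//.
    have : `|h| <= e / (C + 1).
      by near: h; apply: dnbhs0_le; exact: divr_gt0.
    rewrite ler_pdivlMr// mulrC; apply: le_trans.
    by rewrite ler_wpM2r// lerDl.
  by split; [apply/cvg_ex; exists 0|exact: cvg_lim].
Unshelve. all: by end_near. 
Qed.



Lemma Ck_flat k n (U : set R) : open U -> Ck k U (flat n : R -> R).
Proof.
move=> oU; elim: k n => [|k IH] n /=.
  move=> t _; apply: differentiable_continuous; apply/derivable1_diffP.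
  by have [] := is_derive_flat n t.
have df t : differentiable (flat n) t.
  by apply/derivable1_diffP; have [] := is_derive_flat n t.
split=> [t _|v]; first exact: df.
have DC : Ck k U (fun t => v *: (flat n.+2 t + (- n%:R) *: flat n.+1 t) : R).
  apply: CkZ => //; first exact: Ck_cst.
  by apply: CkD => //; apply: CkZ => //; exact: Ck_cst.
apply: Ck_eq DC => // t _.
have [_ dt] := is_derive_flat n t.
have -> : 'D_v (flat n) t = v *: 'D_1 (flat n) t.
  by rewrite !deriveE// -{1}[v]mulr1 linearZ.
by rewrite dt /GRing.scale/= mulNr.
Qed.

(** The step is obtained by composing [flat 0] with itself. With c for
    [flat 0 (b - a)], the function [flat 0 (b - t)] vanishes for [t >= b] and is
    at least c for [t <= a], so that [flat 0 (c - flat 0 (b - t))] is constant on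
    both sides. *)
Lemma smooth_step (a b : R) : a < b -> exists chi dchi : R -> R,
  [/\ forall k, Ck k setT chi,
      forall t : R, is_derive t 1 chi (dchi t) /\ 0 <= dchi t,
      forall t, 0 <= chi t <= 1,
      forall t, t <= a -> chi t = 0 &
      forall t, b <= t -> chi t = 1].
Proof.
move=> ab; pose c := flat 0 (b - a); pose m := flat 0 c.
have c0 : 0 < c by apply: flat_gt0; rewrite subr_gt0.
have m0 : 0 < m by exact: flat_gt0.
pose g (t : R) := c - flat 0 (b - t).
have oT : open [set: R] by exact: openT.
have gC k : Ck k setT g.
  apply: CkD => //; first exact: Ck_cst.
  pose opp : {linear R -> R} := -%R.
  apply: (@Ck_linear_comp _ _ _ _ _ _ (fun t => flat 0 (b - t)) opp) => //.
    by move=> t; exact: opp_continuous.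
  apply: (@Ck_comp _ _ _ _ _ setT setT (fun t => b - t)) => //.
  - exact: has_coordinates_R.
  - apply: CkD => //; first exact: Ck_cst.
    by apply: (@Ck_linear _ _ _ _ _ opp); exact: opp_continuous.
  - exact: Ck_flat.
exists (fun t => m^-1 * flat 0 (g t)), (fun t => m^-1 * (flat 2 (g t) * flat 2 (b - t))); split.
- move=> k; apply: CkZ => //; first exact: Ck_cst.
  apply: (@Ck_comp _ _ _ _ _ setT setT g) => //; first exact: has_coordinates_R.
  exact: Ck_flat.
- move=> t; split; last first.
    by apply: mulr_ge0; [rewrite invr_ge0 ltW|apply: mulr_ge0; exact: flat_ge0].
  have db : is_derive t 1 (fun t : R => b - t) (-1).
    by apply: (is_derive_eq (is_deriveB (is_derive_cst b t 1) (is_derive_id t 1))); rewrite sub0r.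
  have d1 := @is_derive1_comp _ (flat 0) (fun t : R => b - t) t _ _ (is_derive_flat 0 (b - t)) db.
  have dg : is_derive t 1 g (flat 2 (b - t)).
    apply: (is_derive_eq (is_deriveD (is_derive_cst c t 1) (is_deriveN d1))).
    by rewrite mulr0n mul0r subr0 mulrN1 opprK add0r.
  have d2 := @is_derive1_comp _ (flat 0) g t _ _ (is_derive_flat 0 (g t)) dg.
  apply: (is_derive_eq (is_deriveZ m^-1 d2)).
  by rewrite mulr0n mul0r subr0.
- move=> t; rewrite mulr_ge0 ?invr_ge0 ?(ltW m0) ?flat_ge0//= ler_pdivrMl// mulr1.
  by apply: le_flat0; rewrite gerBl flat_ge0.
- move=> t ta; rewrite (@flat_neg 0) ?mulr0// /g subr_le0.
  by apply: le_flat0; rewrite lerD2l lerN2.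
- move=> t tb; rewrite /g (@flat_neg 0 (b - t)) ?subr_le0// subr0.
  by rewrite -/m mulVf// gt_eqF.
Qed.

End smooth_step.

(** * Smooth maps and isotopies of manifolds *)

Section smooth_on_theory.
Context {R : realType}.
Implicit Types V W : normedModType R.

Lemma smooth_on_eq V W (A : set V) (f g : V -> W) :
  (forall x, A x -> f x = g x) -> smooth_on A f -> smooth_on A g.
Proof.
move=> fg fA a /fA [U [h [oU Ua hU hf]]]; exists U, h; split=> // x Ax Ux.
by rewrite hf// fg.
Qed.

Lemma smooth_on_subset V W (A B : set V) (f : V -> W) :
  A `<=` B -> smooth_on B f -> smooth_on A f.
Proof.
move=> AB fB a /AB /fB [U [h [oU Ua hU hf]]]; exists U, h; split=> // x /AB.
exact: hf.
Qed.

Lemma smooth_on_local V W (A : set V) (f : V -> W) :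
  (forall a, A a -> exists O, [/\ open O, O a & smooth_on (A `&` O) f]) ->
  smooth_on A f.
Proof.
move=> fA a Aa; have [N [oN Na fN]] := fA _ Aa.
have [U [h [oU Ua hU hf]]] := fN _ (conj Aa Na).
exists (U `&` N), h; split=> //; first exact: openI.
- by move=> k; apply: Ck_subset (hU k) => x [].
- by move=> x Ax [Ux Nx]; exact: hf.
Qed.

Lemma Ck_smooth_on V W (A : set V) (f : V -> W) :
  (forall k, Ck k setT f) -> smooth_on A f.
Proof. by move=> fC a _; exists setT, f; split=> //; exact: openT. Qed.

Lemma smooth_on_Ck V W (A : set V) (f : V -> W) a : open A ->
  smooth_on A f -> A a -> exists U, [/\ open U, U a, U `<=` A & forall k, Ck k U f].
Proof.
move=> oA fA Aa; have [U [h [oU Ua hU hf]]] := fA _ Aa.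
have oUA : open (U `&` A) by exact: openI.
exists (U `&` A); split=> //.
move=> k; apply: (@Ck_eq _ _ _ _ _ h) => //; first by move=> x [Ux Ax]; exact: hf.
by apply: Ck_subset (hU k) => x [].
Qed.

Lemma smooth_on_pair V W W' (A : set V) (f : V -> W) (g : V -> W') :
  smooth_on A f -> smooth_on A g -> smooth_on A (fun x => (f x, g x)).
Proof.
move=> fA gA a Aa; have [U [h [oU Ua hU hf]]] := fA _ Aa.
have [U' [h' [oU' Ua' hU' hf']]] := gA _ Aa.
have oI := openI oU oU'.
exists (U `&` U'), (fun x => (h x, h' x)); split=> //.
  by move=> k; apply: Ck_pair oI _ _; [apply: Ck_subset (hU k) => x []|
     apply: Ck_subset (hU' k) => x []].
by move=> x Ax [Ux Ux']; rewrite hf// hf'.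
Qed.

Lemma smooth_on_comp V V' W (B : set V) (A : set V') (g : V -> V') (f : V' -> W) :
  has_coordinates V' -> (forall x, B x -> A (g x)) ->
  smooth_on B g -> smooth_on A f -> smooth_on B (f \o g).
Proof.
move=> V'c BA gB fA b Bb; have [U [h [oU Ub hU hg]]] := gB _ Bb.
have hb := hg _ Bb Ub.
have [U' [h' [oU' Ub' hU' hf]]] := fA _ (BA _ Bb).
have hc : {in U, continuous h}.
  by move=> x /set_mem Ux; exact: (Ck_continuous (hU 0%N)).
have oI : open (U `&` h @^-1` U') by exact: (continuous_inP h oU).1.
exists (U `&` h @^-1` U'), (h' \o h); split=> //.
- by split=> //=; rewrite hb.
- move=> k; apply: (@Ck_comp _ _ _ _ _ _ U') => //; first by move=> x [].
  by apply: Ck_subset (hU k) => x [].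
- by move=> x Bx [Ux U'x] /=; rewrite -hg// hf ?hg//; [exact: BA|rewrite -hg].
Qed.

End smooth_on_theory.

Lemma within_continuous_comp (T T' T'' : topologicalType) (A : set T)
    (B : set T') (g : T -> T') (f : T' -> T'') :
  (forall x, A x -> B (g x)) -> {within A, continuous g} ->
  {within B, continuous f} -> {within A, continuous (f \o g)}.
Proof.
move=> AB /subspace_continuousP gA /subspace_continuousP fB.
apply/subspace_continuousP => x Ax.
apply: (@cvg_comp _ _ _ g f _ (within B (nbhs (g x)))); last exact/fB/AB.
move=> P /= /gA - /(_ Ax); rewrite /= !nbhs_simpl/= /within/=.
by apply: filterS => y /= yP Ay; apply: yP => //; exact: AB.
Qed.

Lemma fst_continuous (T U : topologicalType) : continuous (@fst T U).
Proof. by move=> p; exact: cvg_fst. Qed.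

Lemma snd_continuous (T U : topologicalType) : continuous (@snd T U).
Proof. by move=> p; exact: cvg_snd. Qed.

Lemma pair_continuous (S T U : topologicalType) (f : S -> T) (g : S -> U) x :
  {for x, continuous f} -> {for x, continuous g} ->
  {for x, continuous (fun y => (f y, g y))}.
Proof. by move=> fx gx; exact: (cvg_pair fx gx). Qed.

Section manifold_theory.
Context {R : realType} {d : nat} (M : manifold R d).
Implicit Types (i j k : atlas M) (f g : M -> M).

Lemma dom_open i : open (dom i).
Proof. exact: chart_dom_open. Qed.

Lemma loc_img_open i : open (loc i @` dom i).
Proof. exact: chart_img_open. Qed.

Lemma parK i x : dom i x -> par i (loc i x) = x.
Proof. exact: chart_mapK. Qed.

Lemma loc_continuous i x : dom i x -> {for x, continuous (loc i)}.
Proof.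
have := @chart_map_continuous _ _ _ (chart_at i).
rewrite continuous_open_subspace; last exact: chart_dom_open.
by move=> lc ix; apply: lc; exact/mem_set.
Qed.

Lemma par_continuous i p : (loc i @` dom i) p -> {for p, continuous (par i)}.
Proof.
have := @chart_inv_continuous _ _ _ (chart_at i).
rewrite continuous_open_subspace; last exact: chart_img_open.
by move=> lc ip; apply: lc; exact/mem_set.
Qed.

Lemma loc_imgE i (O : set M) :
  loc i @` (dom i `&` O) = (loc i @` dom i) `&` par i @^-1` O.
Proof.
apply/seteqP; split=> [_ [x [ix Ox] <-]|_ [[x ix <-]]] /=.
  by split; [exists x|rewrite /= parK].
by rewrite parK// => Ox; exists x.
Qed.

Lemma open_loc_img i (O : set M) : open O -> open (loc i @` (dom i `&` O)).
Proof.
move=> oO; rewrite loc_imgE; apply: ((continuous_inP (par i) (@loc_img_open i)).1 _ _ oO).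
by move=> p /set_mem; exact: par_continuous.
Qed.

Lemma open_preim f (O : set M) : continuous f -> open O -> open (f @^-1` O).
Proof. by move=> fc; apply: open_comp => x _; exact: fc. Qed.

(** Near a point, a representative of f o g is the composite of
    representatives through a chart around the image by g. *)
Lemma smooth_map_comp f g : smooth_map f -> smooth_map g -> smooth_map (f \o g).
Proof.
move=> [fc fS] [gc gS]; split; first by move=> x; apply: continuous_comp; [exact: gc|exact: fc].
move=> i j; apply: smooth_on_local => _ [x [ix jx] <-].
have [k kx] := atlas_cover (g x).
exists (loc i @` (dom i `&` g @^-1` dom k)); split.
- exact/open_loc_img/open_preim/dom_open.
- by exists x.
apply: (@smooth_on_eq _ _ _ _ ((loc j \o f \o par k) \o (loc k \o g \o par i))).
  by move=> _ [_ [y [iy ky] <-]]; rewrite /= (parK iy) parK.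
apply: (smooth_on_comp (@has_coordinates_rV _ _) _ (smooth_on_subset _ (gS i k)) (fS k j)).
  move=> _ [[y [iy jy] <-]] [z [iz kz]] /= yz; exists (g y); last by rewrite /= parK.
  by split=> //; rewrite -(parK iy) -yz (parK iz).
by move=> _ [_ [y [iy ky] <-]]; exists y.
Qed.


Lemma smooth_isotopy_comp_right (phi : R -> M -> M) g :
  smooth_isotopy phi -> smooth_map g -> smooth_isotopy (fun t => phi t \o g).
Proof.
move=> [phic phiS] [gc gS]; split.
  have := @within_continuous_comp (R * M)%type (R * M)%type M (`[0, 1] `*` setT)
    (`[0, 1] `*` setT) (fun p : R * M => (p.1, g p.2)) (fun p => phi p.1 p.2).
  apply => //.
  apply: continuous_subspaceT => p; apply: pair_continuous; first exact: fst_continuous.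
  by apply: (@continuous_comp _ _ _ snd g); [exact: snd_continuous|exact: gc].
move=> i j; apply: smooth_on_local => -[t _] /= [t01 [x ix <-]]; rewrite parK// => jx.
have [k kx] := atlas_cover (g x).
pose O := loc i @` (dom i `&` g @^-1` dom k).
have oO : open O by exact/open_loc_img/open_preim/dom_open.
exists [set p : R * 'rV[R]_d | O p.2]; split.
- by apply: (@open_comp _ _ snd O) => // p _; exact: cvg_snd.
- by exists x.
pose G (p : R * 'rV[R]_d) := (p.1, (loc k \o g \o par i) p.2).
apply: (@smooth_on_eq _ _ _ _ ((fun p => loc j (phi p.1 (par k p.2))) \o G)).
  by move=> [s q] [_ [y [iy ky] /= <-]]; rewrite /G/= (parK iy) (parK ky).
apply: (smooth_on_comp _ _ _ (phiS k j)).
- exact: has_coordinates_prod (@has_coordinates_R _) (@has_coordinates_rV _ _).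
- move=> [s q] [/= [s01 _ +]] [y [iy ky] yq]; rewrite -yq/= (parK iy) => jy.
  by split=> //=; [exists (g y)|rewrite (parK ky)].
- apply: smooth_on_pair.
    apply: Ck_smooth_on => n.
    by apply: (@Ck_linear _ _ _ _ _ fst) => p; exact: fst_continuous.
  have := @smooth_on_snd _ R^o _ _ setT _ _ (gS i k).
  apply: smooth_on_subset => -[s q] [/= _ [y [iy ky] yq]]; split=> //=.
  by exists y.
Qed.

Lemma smooth_isotopy_reparam (phi : R -> M -> M) (chi : R -> R) :
  smooth_isotopy phi -> (forall m, Ck m setT chi) ->
  (forall t, t \in `[0, 1] -> chi t \in `[0, 1]) ->
  smooth_isotopy (fun t => phi (chi t)).
Proof.
move=> [phic phiS] chiC chi01; split.
  have := @within_continuous_comp (R * M)%type (R * M)%type M (`[0, 1] `*` setT)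
    (`[0, 1] `*` setT) (fun p : R * M => (chi p.1, p.2)) (fun p => phi p.1 p.2).
  apply => //.
    by move=> p [p01 _]; split=> //; exact: chi01.
  apply: continuous_subspaceT => p; apply: pair_continuous; last exact: snd_continuous.
  apply: (@continuous_comp _ _ _ fst chi); first exact: fst_continuous.
  exact: (Ck_continuous (chiC 0%N)).
move=> i j; pose G (p : R * 'rV[R]_d) := (chi p.1, p.2).
apply: (@smooth_on_eq _ _ _ _ ((fun p => loc j (phi p.1 (par i p.2))) \o G)).
  by [].
apply: (smooth_on_comp _ _ _ (phiS i j)).
- exact: has_coordinates_prod (@has_coordinates_R _) (@has_coordinates_rV _ _).
- by move=> [s q] [/= s01 iq jq]; split=> //; exact: chi01.
- apply: Ck_smooth_on => n; apply: Ck_pair; first exact: openT.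
    apply: (@Ck_comp _ _ _ _ _ _ setT fst chi) => //.
    + exact: has_coordinates_R.
    + exact: openT.
    + by apply: (@Ck_linear _ _ _ _ _ fst) => p; exact: fst_continuous.
  by apply: (@Ck_linear _ _ _ _ _ snd) => p; exact: snd_continuous.
Qed.

Lemma smooth_isotopy_local (phi : R -> M -> M) :
  (forall t : R, t \in `[0, 1] -> exists (I : set R) psi, [/\ open I, I t, smooth_isotopy psi &
     forall s, s \in `[0, 1] -> I s -> phi s = psi s]) -> smooth_isotopy phi.
Proof.
move=> phil; split.
  apply/subspace_continuousP => -[t x] [/= t01 _].
  have [I [psi [oI It [psic _] phipsi]]] := phil _ t01.
  have E : phi t x = psi t x by rewrite phipsi.
  have /subspace_continuousP/(_ (t, x) (conj t01 Logic.I))/= := psic.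
  rewrite /from_subspace/= -E; apply: cvg_trans.
  have nI : \forall p \near (t, x), I p.1.
    exact: (@fst_continuous R M (t, x) I (open_nbhs_nbhs (conj oI It))).
  apply: near_eq_cvg; rewrite near_withinE.
  by apply: filterS nI => -[s y] /= Is [s01 _]; rewrite /= phipsi.
move=> i j; apply: smooth_on_local => -[t q] [/= t01 iq jq].
have [I [psi [oI It [_ psiS] phipsi]]] := phil _ t01.
exists [set p : R * 'rV[R]_d | I p.1]; split=> //.
  by apply: (@open_comp _ _ fst I) => // p _; exact: cvg_fst.
apply: (@smooth_on_eq _ _ _ _ (fun p => loc j (psi p.1 (par i p.2)))).
  by move=> p [[/= p01 _ _] Ip]; rewrite phipsi.
apply: smooth_on_subset (psiS i j) => p [[/= p01 ip jp] Ip]; split=> //.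
by rewrite -phipsi.
Qed.

End manifold_theory.

(** * Push-forward of tangent vectors and the group of contactomorphisms *)

Section pushforward.
Context {R : realType} {d : nat} (M : manifold R d).
Implicit Types (i j k : atlas M) (f g : M -> M).

Lemma smooth_map_idfun : smooth_map (@id M).
Proof. by split=> [x|i j]; [exact: cvg_id|exact: atlas_compatible]. Qed.

Lemma rep_smooth f i j x : smooth_map f -> dom i x -> dom j (f x) ->
  exists U, [/\ open U, U (loc i x),
    U `<=` loc i @` (dom i `&` f @^-1` dom j) &
    forall m, Ck m U (loc j \o f \o par i)].
Proof.
move=> [fc fS] ix jx.
apply: (smooth_on_Ck _ (fS i j)); last by exists x.
exact/open_loc_img/open_preim/dom_open.
Qed.

Lemma rep_differentiable f i j x : smooth_map f -> dom i x -> dom j (f x) ->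
  differentiable (loc j \o f \o par i) (loc i x).
Proof.
by move=> fS ix jx; have [U [_ Ux _ /(_ 1%N)[df _]]] := rep_smooth fS ix jx; exact: df.
Qed.

Lemma diff_rep_comp f g i j k x : smooth_map f -> smooth_map g ->
  dom i x -> dom k (g x) -> dom j (f (g x)) ->
  forall v, 'd (loc j \o (f \o g) \o par i) (loc i x) v =
    'd (loc j \o f \o par k) (loc k (g x)) ('d (loc k \o g \o par i) (loc i x) v).
Proof.
move=> fS gS ix kx jx v.
have dg := rep_differentiable gS ix kx.
have E : (loc k \o g \o par i) (loc i x) = loc k (g x) by rewrite /= parK.
have df : differentiable (loc j \o f \o par k) ((loc k \o g \o par i) (loc i x)).
  by rewrite E; exact: rep_differentiable.
have nfg : \forall p \near loc i x,
    ((loc j \o f \o par k) \o (loc k \o g \o par i)) p = (loc j \o (f \o g) \o par i) p.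
  have oO := @open_loc_img _ _ M i _ (open_preim gS.1 (@dom_open _ _ M k)).
  have : (loc i @` (dom i `&` g @^-1` dom k)) (loc i x) by exists x.
  move=> /(conj oO)/open_nbhs_nbhs; apply: filterS => _ [y [iy ky] <-].
  by rewrite /= (parK iy) (parK ky).
have [_ dE] := near_eq_diff nfg (differentiable_comp dg df).
apply: etrans (congr1 (fun h => h v) dE) _.
apply: etrans (congr1 (fun h => h v) (diff_comp dg df)) _.
by rewrite /= (parK ix).
Qed.

Lemma tangent_eq (x : M) (v w : tangent x) i : dom i x -> v i = w i -> v = w.
Proof.
move=> ix vwi; have E : tcoord v = tcoord w.
  apply/funext => j; have [jx|jx] := pselect (dom j x).
    by rewrite (tcoord_change v ix jx) (tcoord_change w ix jx) vwi.
  by rewrite !tcoord_out.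
case: v w E {vwi} => v v1 v2 [w w1 w2] /= E.
by case: _ / E in w1 w2 *; congr Tangent; exact: Prop_irrelevance.
Qed.

Lemma pushforward_comp f g (x : M) (u : tangent x) (v : tangent (g x))
    (w : tangent (f (g x))) : smooth_map f -> smooth_map g ->
  is_pushforward u v -> is_pushforward v w ->
  @is_pushforward _ _ _ (f \o g) x u w.
Proof.
move=> fS gS uv vw i j ix jx; have [k kx] := atlas_cover (g x).
apply: etrans (vw _ _ kx jx) _; rewrite (uv _ _ ix kx).
exact: esym (diff_rep_comp fS gS ix kx jx _).
Qed.

Lemma pushforward_unique f (x : M) (u : tangent x) (w w' : tangent (f x)) :
  is_pushforward u w -> is_pushforward u w' -> w = w'.
Proof.
move=> uw uw'; have [i ix] := atlas_cover x; have [j jx] := atlas_cover (f x).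
by apply: (tangent_eq jx); exact: etrans (uw _ _ ix jx) (esym (uw' _ _ ix jx)).
Qed.

(** The coordinates of the image are computed from those of u in one chart i0 at
    x; the chain rule makes them consistent and independent of i0. *)
Lemma pushforward_exists f (x : M) (u : tangent x) : smooth_map f ->
  exists w : tangent (f x), is_pushforward u w.
Proof.
move=> fS; have [i0 ix0] := atlas_cover x.
pose c j := if pselect (dom j (f x)) then 'd (loc j \o f \o par i0) (loc i0 x) (u i0) else 0.
have cE j : dom j (f x) -> c j = 'd (loc j \o f \o par i0) (loc i0 x) (u i0).
  by rewrite /c; case: pselect.
have c1 j k : dom j (f x) -> dom k (f x) ->
    c k = 'd (loc k \o par j) (loc j (f x)) (c j).
  move=> jx kx; apply: etrans (cE _ kx) _; rewrite (cE _ jx).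
  exact: (diff_rep_comp smooth_map_idfun fS ix0 jx kx).
have c2 j : ~ dom j (f x) -> c j = 0 by rewrite /c; case: pselect.
exists (Tangent c1 c2) => i j ix jx; apply: etrans (cE _ jx) _.
rewrite (tcoord_change u ix ix0).
exact: esym (diff_rep_comp fS smooth_map_idfun ix ix0 jx _).
Qed.

(** A map which is only propositionally the identity, such as f o g for g inverse
    to f, does not let vectors at x be used at f x; this lemma transports them,
    together with all the properties stated uniformly in the base point. *)
Lemma pushforward_id_ex f (x : M) (w : tangent (f x)) : f = id ->
  exists2 v : tangent x, is_pushforward v w &
  forall P : forall y, set (tangent y), P _ w -> P _ v.
Proof.
move=> fid; subst f; exists w => // i j ix jx; exact: tcoord_change.
Qed.

Lemma pushforward_id_inj f (x : M) (v v' : tangent x) (w : tangent (f x)) :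
  f = id -> is_pushforward v w -> is_pushforward v' w -> v = v'.
Proof.
move=> fid; subst f => vw vw'; have [i ix] := atlas_cover x.
have key (u : tangent x) : @is_pushforward _ _ M id x u w -> w i = u i.
  by move=> uw; apply: etrans (uw _ _ ix ix) (esym (tcoord_change u ix ix)).
by apply: (tangent_eq ix); rewrite -(key v) // -(key v').
Qed.

End pushforward.

Section contactomorphism_group.
Context {R : realType} {n : nat} (M : closed_contact_manifold R n).

Lemma diffeomorphism_comp (f g : M -> M) :
  diffeomorphism f -> diffeomorphism g -> diffeomorphism (f \o g).
Proof.
move=> [fS [f' [fS' fK fK']]] [gS [g' [gS' gK gK']]].
split; first exact: smooth_map_comp.
exists (g' \o f'); split; first exact: smooth_map_comp.
  by move=> x /=; rewrite fK gK.
by move=> x /=; rewrite gK' fK'.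
Qed.

Lemma contactomorphism_comp (f g : M -> M) :
  contactomorphism f -> contactomorphism g -> contactomorphism (f \o g).
Proof.
move=> [fD fxi] [gD gxi]; split; first exact: diffeomorphism_comp.
have fS := fD.1; have gS := gD.1 => x; apply/seteqP; split=> [w|w [u xu uw]] /=.
  rewrite [X in X _ -> _]fxi => -[v + vw]; rewrite gxi => -[u xu uv].
  by exists u => //; exact: pushforward_comp uv vw.
have [v uv] := pushforward_exists u gS.
have [w' vw'] := pushforward_exists v fS.
have -> : w = w' by exact: pushforward_unique uw (pushforward_comp fS gS uv vw').
by rewrite [X in X _]fxi; exists v => //; rewrite gxi; exists u.
Qed.

(** Push-forward by g undoes push-forward by f, so that preservation of [xi] by
    f, read from right to left, is preservation by g. *)
Lemma contactomorphism_inv (f g : M -> M) : smooth_map g ->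
  cancel f g -> cancel g f -> contactomorphism f -> contactomorphism g.
Proof.
move=> gS fK gK [fD fxi]; have fS := fD.1.
split; first by split=> //; exists f.
have fg : f \o g = id by apply/funext => x /=; rewrite gK.
have gf : g \o f = id by apply/funext => x /=; rewrite fK.
have finj x (v v' : tangent x) (w : tangent (f x)) :
    is_pushforward v w -> is_pushforward v' w -> v = v'.
  move=> vw vw'; have [u wu] := pushforward_exists w gS.
  exact: (pushforward_id_inj gf (pushforward_comp gS fS vw wu)
                                (pushforward_comp gS fS vw' wu)).
move=> y; apply/seteqP; split=> [v xv|v [w xw wv]].
  have [w' vw'] := pushforward_exists v fS.
  have xw' : xi M _ w' by rewrite fxi; exists v.
  have [w ww' Pw] := @pushforward_id_ex _ _ _ (f \o g) y w' fg.
  exists w; first exact: Pw xw'.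
  have [v' wv'] := pushforward_exists w gS.
  have [w'' vw''] := pushforward_exists v' fS.
  have E : w'' = w' := pushforward_unique (pushforward_comp fS gS wv' vw'') ww'.
  by move: vw''; rewrite E => vw''; rewrite (finj _ _ _ _ vw' vw'').
have [w' vw'] := pushforward_exists v fS.
have ww' := pushforward_comp fS gS wv vw'.
have [w0 ww0 Pw0] := @pushforward_id_ex _ _ _ (f \o g) y w' fg.
have xw' : xi M _ w'.
  have fxi' : forall h : M -> M, h = id -> forall z (a : tangent z) (b : tangent (h z)),
      is_pushforward a b -> xi M _ a -> xi M _ b.
    by move=> h hid; subst h => z a b /pushforward_id <-.
  exact: (fxi' _ fg _ _ _ ww').
by move: xw'; rewrite fxi => -[v0 xv0 v0w']; rewrite (finj _ _ _ _ vw' v0w').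
Qed.

End contactomorphism_group.

(** * Concatenation and translation of contact isotopies *)

Section scaled_tangent.
Context {R : realType} {d : nat} (M : manifold R d).

Lemma scale_tangent_change (x : M) (a : R) (v : tangent x) i j :
  dom i x -> dom j x -> a *: v j = 'd (loc j \o par i) (loc i x) (a *: v i).
Proof.
move=> ix jx; rewrite (tcoord_change v ix jx).
by rewrite [in RHS]linearZ.
Qed.

Lemma scale_tangent_out (x : M) (a : R) (v : tangent x) i :
  ~ dom i x -> a *: v i = 0.
Proof. by move=> ix; rewrite tcoord_out// scaler0. Qed.

Definition scale_tangent (x : M) (a : R) (v : tangent x) : tangent x :=
  Tangent (@scale_tangent_change x a v) (@scale_tangent_out x a v).

Lemma contact_formZ (alpha : forall x : M, tangent x -> R) :
  contact_form alpha -> forall x (a : R) (v : tangent x),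
  alpha x (scale_tangent a v) = a * alpha x v.
Proof.
move=> ca x a v; have [i ix] := atlas_cover x; have [b [_ bE _]] := ca i.
by rewrite !bE// -scalemxAl mxE.
Qed.

Lemma generated_by_local (phi : R -> M -> M) (X : R -> forall x : M, tangent x) :
  (forall t : R, t \in `[0, 1] -> exists (I : set R) psi Y,
     [/\ open I, I t, generated_by psi Y, X t = Y t &
         forall s, s \in `[0, 1] -> I s -> phi s = psi s]) ->
  generated_by phi X.
Proof.
move=> phil t x i t01; have [I [psi [Y [oI It gen -> E]]]] := phil _ t01.
rewrite (E _ t01 It) => ix; apply: cvg_trans (gen _ _ _ t01 ix).
apply: near_eq_cvg; rewrite near_withinE; apply: cvg_within.
have : nbhs t I by exact: open_nbhs_nbhs.
by apply: filterS => s Is s01; rewrite E.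
Qed.

(** The quotient of the reparametrized curve is the product of the quotients of
    chi and of the curve; as chi may take the value [chi t] at other times, the
    latter is extended by its limit. *)
Lemma generated_by_reparam (phi : R -> M -> M) (X : R -> forall x : M, tangent x)
    (chi dchi : R -> R) :
  (forall t : R, is_derive t 1 chi (dchi t)) ->
  (forall t, t \in `[0, 1] -> chi t \in `[0, 1]) ->
  generated_by phi X ->
  generated_by (fun t => phi (chi t)) (fun t x => scale_tangent (dchi t) (X (chi t) x)).
Proof.
move=> dc c01 gen t x i t01 ix.
set tau := chi t in ix *; pose F s := loc i (phi s x).
have tau01 : tau \in `[0, 1] by exact: c01.
have := gen _ _ _ tau01 ix; set L := X tau _ i => genL.
pose q s := if s == tau then L else (s - tau)^-1 *: (F s - F tau).
have qL : q s @[s --> within `[0, 1] (nbhs tau)] --> L.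
  move=> P nP.
  have gP : \forall s \near tau, s != tau -> s \in `[0, 1] ->
    P ((s - tau)^-1 *: (F s - F tau)) by exact: genL nP.
  change (\forall s \near tau, s \in `[0, 1] -> P (q s)).
  apply: filterS gP => s sP s01; rewrite /q; case: eqVneq => [_|sn].
    exact: nbhs_singleton nP.
  exact: sP.
have chic : {for t, continuous chi}.
  by apply: differentiable_continuous; apply/derivable1_diffP; have [] := dc t.
have qcL : q (chi s) @[s --> within `[0, 1] t^'] --> L.
  apply: (@cvg_comp _ _ _ chi q _ (within `[0, 1] (nbhs tau))); last exact: qL.
  move=> P nP; have cP : \forall s \near t, chi s \in `[0, 1] -> P (chi s).
    exact: chic nP.
  change (\forall s \near t, s != t -> s \in `[0, 1] -> P (chi s)).
  by apply: filterS cP => s sP _ s01; apply: sP; exact: c01.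
have dq : (s - t)^-1 * (chi s - chi t) @[s --> within `[0, 1] t^'] --> dchi t.
  have [ex <-] := dc t; apply: cvg_trans (ex).
  move=> P nP.
  have {}nP : \forall h \near (0 : R), h != 0 ->
    P (h^-1 *: (chi (h *: 1 + t) - chi t)) by exact: nP.
  change (\forall s \near t, s != t -> s \in `[0, 1] ->
    P ((s - t)^-1 * (chi s - chi t))).
  have sub : {for t, continuous (fun s : R => s - t)}.
    by apply: continuousB; [exact: cvg_id|exact: cvg_cst].
  have {}nP : \forall s \near t, s - t != 0 ->
      P ((s - t)^-1 *: (chi ((s - t) *: 1 + t) - chi t)).
    have nP0 : nbhs (t - t) [set h | h != 0 ->
      P (h^-1 *: (chi (h *: 1 + t) - chi t))] by rewrite subrr.
    exact: (sub _ nP0).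
  apply: filterS nP => s /= sP st _; have := sP; rewrite subr_eq0 => /(_ st).
  by rewrite [_ *: 1]mulr1 subrK.
have E : (fun s => ((s - t)^-1 * (chi s - chi t)) *: q (chi s)) =
         (fun s => (s - t)^-1 *: (F (chi s) - F tau)).
  apply/funext => s; rewrite /q; case: eqVneq => [->|sn].
    by rewrite subrr mulr0 scale0r subrr scaler0.
  by rewrite scalerA mulfK// subr_eq0.
have := cvgZ dq qcL; rewrite [X in X @ _]E; exact.
Qed.

End scaled_tangent.

Section contact_isotopies.
Context {R : realType} {n : nat} (M : closed_contact_manifold R n).

(** Both inequalities say that v lies in [xi] or is positively transverse to it,
    which does not involve the form. *)
Lemma supports_ge0 (alpha beta : forall x : M, tangent x -> R) :
  supports alpha (xi M) (positive M) -> supports beta (xi M) (positive M) ->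
  forall x (v : tangent x), 0 <= alpha x v -> 0 <= beta x v.
Proof.
move=> [_ sa] [_ sb] x v; have [xia posa] := sa x; have [xib posb] := sb x.
rewrite le_eqVlt => /orP[/eqP/esym va|va].
  have : xi M x v by rewrite xia.
  by rewrite xib/= => ->.
have : positive M x v by rewrite posa.
by rewrite posb/= => /ltW.
Qed.

Lemma nonneg_hamiltonianP (phi : R -> M -> M)
    (alpha : forall x : M, tangent x -> R) :
  supports alpha (xi M) (positive M) ->
  nonneg_hamiltonian phi <-> exists2 X, generated_by phi X &
    forall t x, t \in `[0, 1] -> 0 <= alpha x (X t x).
Proof.
move=> sa; split=> [[beta [X [sb gen X0]]]|[X gen X0]]; last by exists alpha, X.
by exists X => // t x t01; apply: supports_ge0 sb sa _ _ _; exact: X0.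
Qed.

Lemma contact_isotopy_comp_right (phi : R -> M -> M) (g : M -> M) :
  contact_isotopy phi -> contactomorphism g ->
  contact_isotopy (fun t => phi t \o g).
Proof.
move=> [phiS phiC] gC; split; first exact: smooth_isotopy_comp_right phiS gC.1.1.
by move=> t /phiC phitC; exact: contactomorphism_comp.
Qed.

(** A curve phi_t (g x) is an integral curve of any field generating phi: right
    composition does not change the Hamiltonian. *)
Lemma nonneg_hamiltonian_comp_right (phi : R -> M -> M) (g : M -> M) :
  nonneg_hamiltonian phi -> nonneg_hamiltonian (fun t => phi t \o g).
Proof.
move=> [alpha [X [sa gen X0]]]; exists alpha, X; split=> // t x i t01 ix.
exact: gen.
Qed.

Lemma contact_isotopy_reparam (phi : R -> M -> M) (chi : R -> R) :
  contact_isotopy phi -> (forall k, Ck k setT chi) ->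
  (forall t, t \in `[0, 1] -> chi t \in `[0, 1]) ->
  contact_isotopy (fun t => phi (chi t)).
Proof.
move=> [phiS phiC] chiC c01; split; first exact: smooth_isotopy_reparam.
by move=> t t01; apply: phiC; exact: c01.
Qed.

Lemma contact_isotopy_rescale (phi : R -> M -> M) (a b : R) :
  contact_isotopy phi ->
  (forall t, t \in `[0, 1] -> a * t + b \in `[0, 1]) ->
  contact_isotopy (fun t => phi (a * t + b)).
Proof.
move=> phiC ab; apply: contact_isotopy_reparam => // k.
apply: CkD; first exact: openT; last exact: Ck_cst.
apply: CkZ; [exact: openT|exact: Ck_cst|].
by apply: (@Ck_linear _ _ _ _ _ idfun) => t; exact: cvg_id.
Qed.

(** Concatenation of isotopies. Each one is slowed down to be constant near its
    ends, so that the result is smooth: it is a reparametrization of the first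
    isotopy for [t < 5/8] and one of the second for [3/8 < t]. *)
Lemma contact_isotopy_concat : exists chi1 chi2 : R -> R,
  [/\ continuous chi1 /\ continuous chi2,
      (forall t, 0 <= chi1 t <= 1) /\ (forall t, 0 <= chi2 t <= 1),
      [/\ chi1 0 = 0, chi1 2^-1 = 1, chi2 2^-1 = 0 & chi2 1 = 1] &
      forall (T : Type) (p : T -> M -> M) (z1 z2 : R -> T), z1 1 = z2 0 ->
        let z t := if t <= 2^-1 then z1 (chi1 t) else z2 (chi2 t) in
        [/\ contact_isotopy (p \o z1) -> contact_isotopy (p \o z2) ->
            contact_isotopy (p \o z) &
            nonneg_hamiltonian (p \o z1) -> nonneg_hamiltonian (p \o z2) ->
            nonneg_hamiltonian (p \o z)]].
Proof.
have h1 : 8^-1 < 3 / 8 :> R by lra.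
have h2 : 5 / 8 < 7 / 8 :> R by lra.
have [c1 [d1 [c1C c1d c1b c10 c11]]] := smooth_step h1.
have [c2 [d2 [c2C c2d c2b c20 c21]]] := smooth_step h2.
exists c1, c2; split.
- by split; move=> t; [exact: (Ck_continuous (c1C 0%N))|exact: (Ck_continuous (c2C 0%N))].
- by [].
- by split; [apply: c10|apply: c11|apply: c20|apply: c21]; lra.
move=> T p z1 z2 z12 z.
have zl t : t < 5 / 8 -> z t = z1 (c1 t).
  move=> t5; rewrite /z; have [//|t2] := leP t 2^-1; have t3 : 3 / 8 <= t by lra.
  by rewrite (c20 _ (ltW t5)) (c11 _ t3).
have zr t : 3 / 8 < t -> z t = z2 (c2 t).
  move=> t3; rewrite /z; have [t2|//] := leP t 2^-1; have t5 : t <= 5 / 8 by lra.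
  by rewrite (c20 _ t5) (c11 _ (ltW t3)).
have c1i t : t \in `[0, 1] -> c1 t \in `[0, 1] by rewrite !in_itv/= => _.
have c2i t : t \in `[0, 1] -> c2 t \in `[0, 1] by rewrite !in_itv/= => _.
have oI1 : open [set t : R | t < 5 / 8] by exact: open_lt.
have oI2 : open [set t : R | 3 / 8 < t] by exact: open_gt.
split=> [iso1 iso2|].
  have iso1' := contact_isotopy_reparam iso1 c1C c1i.
  have iso2' := contact_isotopy_reparam iso2 c2C c2i.
  split=> [|t t01]; last first.
    rewrite /=; have [t2|t2] := leP t 2^-1.
      by rewrite zl; [exact: iso1'.2|lra].
    by rewrite zr; [exact: iso2'.2|lra].
  apply: smooth_isotopy_local => t t01; have [t2|t2] := leP t 2^-1.
    exists [set t | t < 5 / 8], (fun t => p (z1 (c1 t))); split=> //=; first lra.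
      exact: iso1'.1.
    by move=> s _ /zl ->.
  exists [set t | 3 / 8 < t], (fun t => p (z2 (c2 t))); split=> //=; first lra.
    exact: iso2'.1.
  by move=> s _ /zr ->.
have [alpha sa] := contact_supported M.
rewrite !(nonneg_hamiltonianP _ sa) => -[X1 gen1 X10] [X2 gen2 X20].
have gen1' := generated_by_reparam (fun t => (c1d t).1) c1i gen1.
have gen2' := generated_by_reparam (fun t => (c2d t).1) c2i gen2.
exists (fun t x => if t <= 2^-1 then scale_tangent (d1 t) (X1 (c1 t) x)
                   else scale_tangent (d2 t) (X2 (c2 t) x)).
  apply: generated_by_local => t t01; have [t2|t2] := leP t 2^-1.
    exists [set t | t < 5 / 8], (fun t => p (z1 (c1 t))),
      (fun t x => scale_tangent (d1 t) (X1 (c1 t) x)); split=> //=; first lra.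
    by move=> s _ /zl ->.
  exists [set t | 3 / 8 < t], (fun t => p (z2 (c2 t))),
    (fun t x => scale_tangent (d2 t) (X2 (c2 t) x)); split=> //=; first lra.
  by move=> s _ /zr ->.
move=> t x t01; case: (leP t 2^-1) => _; rewrite (contact_formZ sa.1).
  by rewrite mulr_ge0 ?(c1d t).2// X10// c1i.
by rewrite mulr_ge0 ?(c2d t).2// X20// c2i.
Qed.

Lemma Gspace_eq (f g : Gspace M) : sval f = sval g -> f = g.
Proof. by case: f g => [f Pf] [g Pg] /= fg; exact: eq_exist. Qed.

(** First an isotopy from id to g, then one from id to f composed with g. *)
Lemma isotopic_to_id_comp (f g : M -> M) : contactomorphism g ->
  isotopic_to_id f -> isotopic_to_id g -> isotopic_to_id (f \o g).
Proof.
move=> gC [phi [phiI phi0 phi1]] [psi [psiI psi0 psi1]].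
have [c1 [c2 [_ _ [c10 c11 c20 c21] cat]]] := contact_isotopy_concat.
have E : psi 1 = phi 0 \o g by rewrite psi1 phi0.
have [iso _] := cat (M -> M) id psi (fun t => phi t \o g) E.
eexists; split; first exact: iso psiI (contact_isotopy_comp_right phiI gC).
  by rewrite /= ifT ?c10//; lra.
by rewrite /= ifF ?c21 ?phi1//; apply/negbTE; rewrite -ltNge; lra.
Qed.

Lemma Gmul_subproof (f g : Gspace M) :
  contactomorphism (sval f \o sval g) /\ isotopic_to_id (sval f \o sval g).
Proof.
have [fC fI] := svalP f; have [gC gI] := svalP g.
by split; [exact: contactomorphism_comp|exact: isotopic_to_id_comp].
Qed.

(** Right multiplication by g; the arguments are in this order for it to be a
    map [Gmul g] of the group to itself. *)
Definition Gmul (g f : Gspace M) : Gspace M := exist _ _ (Gmul_subproof f g).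

(** The inverse of the end of an isotopy is the end of the reversed isotopy,
    composed with this inverse. *)
Lemma Gspace_inv (f : Gspace M) :
  exists g : Gspace M, cancel (sval f) (sval g) /\ cancel (sval g) (sval f).
Proof.
case: f => f [fC [phi [phiI phi0 phi1]]] /=.
have [_ [g [gS fK gK]]] := fC.1.
have gC : contactomorphism g by exact: contactomorphism_inv fC.
suff gI : isotopic_to_id g by exists (exist _ g (conj gC gI)).
have revI : contact_isotopy (fun t => phi (- 1 * t + 1)).
  by apply: contact_isotopy_rescale => // t; rewrite !in_itv/=; lra.
exists (fun t => phi (- 1 * t + 1) \o g); split.
- exact: contact_isotopy_comp_right revI gC.
- by rewrite mulr0 add0r phi1; apply/funext => x /=; rewrite gK.
- by rewrite mulr1 addNr phi0.
Qed.

Lemma GmulK (f g h : Gspace M) : cancel (sval g) (sval f) ->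
  Gmul g (Gmul f h) = h.
Proof. by move=> fg; apply: Gspace_eq; apply/funext => x /=; rewrite fg. Qed.

Lemma Gle_trans (x y z : Gspace M) : Gle x y -> Gle y z -> Gle x z.
Proof.
move=> [z1 [iso1 z10 z11 pos1]] [z2 [iso2 z20 z21 pos2]].
have [c1 [c2 [_ _ [c10 c11 c20 c21] cat]]] := contact_isotopy_concat.
have E : z1 1 = z2 0 by rewrite z11 z20.
have [iso pos] := cat (Gspace M) sval z1 z2 E.
eexists; split; [exact: iso iso1 iso2| | |exact: pos pos1 pos2].
  by rewrite /= ifT ?c10//; lra.
by rewrite /= ifF ?c21//; apply/negbTE; rewrite -ltNge; lra.
Qed.

Lemma Gle_mul (g x y : Gspace M) : Gle x y -> Gle (Gmul g x) (Gmul g y).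
Proof.
move=> [z [iso z0 z1 pos]]; exists (fun t => Gmul g (z t)); split.
- exact: contact_isotopy_comp_right iso (svalP g).1.
- by rewrite z0.
- by rewrite z1.
- exact: nonneg_hamiltonian_comp_right.
Qed.

End contact_isotopies.

(** * Continuity of right translations in the C^1-topology *)

Section C1_topology.
Context {R : realType} {n : nat} (M : closed_contact_manifold R n).

Lemma nbhs_subbase (T S : topologicalType) (B : set (set S)) (F : T -> S) x :
  (forall U, open U -> exists2 D, D `<=` finI_from B id & \bigcup_(i in D) i = U) ->
  (forall N, B N -> N (F x) -> nbhs x (F @^-1` N)) ->
  {for x, continuous F}.
Proof.
move=> oB FN P; rewrite nbhsE => -[U [oU Ux] UP].
apply: (@filterS _ _ _ (F @^-1` U)) => [y /UP//|].
have [D DB DU] := oB _ oU; move: Ux; rewrite -DU => -[V DV Vx].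
apply: (@filterS _ _ _ (F @^-1` V)) => [y Vy|]; first by exists V.
have [E EB EV] := DB _ DV; move: Vx; rewrite -EV => Vx.
rewrite preimage_bigcap; apply: filter_bigI => N NE.
by apply: FN; [apply/set_mem; exact: EB|exact: Vx].
Qed.

Lemma Gspace_openP (U : set (Gspace M)) : open U ->
  exists2 D, D `<=` finI_from (@C1_subbase R n M) id & \bigcup_(i in D) i = U.
Proof. by move=> [D sD <-]; exists D. Qed.

Lemma C1_subbase_open (U : set (Gspace M)) : C1_subbase U -> open U.
Proof.
move=> bU; exists [set U]; last by rewrite bigcup_set1.
move=> _ ->; exists [fset U]%fset; first by move=> V /fset1P ->; exact/mem_set.
by rewrite set_fset1 bigcap_set1.
Qed.

Lemma normr_coord d (v : 'rV[R]_d) l : `|v 0 l| <= `|v|.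
Proof.
rewrite [leRHS]/Num.Def.normr/= mx_normrE.
exact: (le_bigmax _ (fun i : 'I_1 * 'I_d => `|v i.1 i.2|) (0, l)).
Qed.

(** The condition at x whose conjunction over K is [C1_nbhd f i j K e]; it is
    isolated so that compactness of K can be used one point at a time. *)
Definition C1_close_at (f h : Gspace M) (i j : atlas M) (e : R) (x : M) : Prop :=
  [/\ dom j (sval h x), `|loc j (sval h x) - loc j (sval f x)| < e &
      exists2 e', e' < e & forall v : 'rV[R]_(n.*2.+1), `|v| <= 1 ->
        `|'d (loc j \o sval h \o par i) (loc i x) v -
          'd (loc j \o sval f \o par i) (loc i x) v| <= e'].

Lemma linear_rowE d (W : lmodType R) (L : {linear 'rV[R]_d -> W}) v :
  L v = \sum_l v 0 l *: L (delta_mx 0 l).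
Proof.
by rewrite {1}(row_sum_delta v) linear_sum; apply: eq_bigr => l _; rewrite linearZ.
Qed.

Lemma linear_dist d (W : normedModType R) (L1 L2 : {linear 'rV[R]_d -> W}) (c : R) :
  (forall l, `|L1 (delta_mx 0 l) - L2 (delta_mx 0 l)| <= c) ->
  forall v : 'rV[R]_d, `|v| <= 1 -> `|L1 v - L2 v| <= c * d%:R.
Proof.
move=> Lc v v1; rewrite (linear_rowE L1) (linear_rowE L2) -sumrB.
apply: le_trans (ler_norm_sum _ _ _) _.
have -> : c * d%:R = \sum_(l < d) c by rewrite sumr_const card_ord mulr_natr.
apply: ler_sum => l _; rewrite -scalerBr normrZ -[leRHS]mul1r.
by apply: ler_pM => //; exact: le_trans (normr_coord _ _) v1.
Qed.

(** In finite dimension the operator norm is controlled by the finitely many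
    partial derivatives, and these are continuous. *)
Lemma diff_rep_near (f : M -> M) i j (x0 : M) (e : R) : 0 < e ->
  smooth_map f -> dom i x0 -> dom j (f x0) ->
  \forall x \near x0, forall v : 'rV[R]_(n.*2.+1), `|v| <= 1 ->
    `|'d (loc j \o f \o par i) (loc i x) v -
      'd (loc j \o f \o par i) (loc i x0) v| <= e.
Proof.
move=> e0 fS ix0 jx0; set F := loc j \o f \o par i.
have [U [oU Ux0 Udom /(_ 1%N)[dF DF]]] := rep_smooth fS ix0 jx0.
pose c := e / (n.*2.+1)%:R.
have c0 : 0 < c by rewrite divr_gt0.
have lx := loc_continuous ix0.
have nU : \forall x \near x0, U (loc i x).
  by apply: lx; exact: open_nbhs_nbhs.
have nD : \forall x \near x0, forall l : 'I_(n.*2.+1),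
    `|'D_(delta_mx 0 l) F (loc i x) - 'D_(delta_mx 0 l) F (loc i x0)| <= c.
  apply: filter_forall => l.
  have Dc : {for x0, continuous ('D_(delta_mx 0 l) F \o loc i)}.
    by apply: continuous_comp => //; exact: (DF (delta_mx 0 l) _ Ux0).
  move/cvgrPdist_le : Dc => /(_ _ c0); apply: filterS => x xc.
  rewrite distrC; exact: xc.
apply: filterS2 nU nD => x Ux xD v v1.
have {}xD l : `|'d F (loc i x) (delta_mx 0 l) - 'd F (loc i x0) (delta_mx 0 l)| <= c.
  have := xD l; rewrite (deriveE _ (dF _ Ux)) (deriveE _ (dF _ Ux0)); exact.
apply: le_trans (linear_dist xD v1) _.
by rewrite /c divfK.
Qed.

Lemma composed_dist (V W : normedModType R) (L1 L0 : {linear V -> W}) (w : V)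
    (a1 a0 b : W) (e1 C e : R) : 0 < C ->
  (forall v, `|v| <= 1 -> `|L1 v - L0 v| <= e1) -> `|w| <= C ->
  a1 = L1 w -> a0 = L0 w -> `|a0 - b| <= e -> `|a1 - b| <= C * e1 + e.
Proof.
move=> C0 L10 wC -> -> a0b; apply: le_trans (ler_distD (L0 w) _ _) _.
apply: lerD => //.
have [u wE u1] : exists2 u, w = C *: u & `|u| <= 1.
  exists (C^-1 *: w); first by rewrite scalerA divff ?gt_eqF// scale1r.
  by rewrite normrZ normfV gtr0_norm// ler_pdivrMl// mulr1.
rewrite wE [L1 _]linearZ [L0 _]linearZ -scalerBr normrZ gtr0_norm// ler_pM2l//.
exact: L10.
Qed.

Lemma norm_dist_le (V : normedModType R) (a b : V) (c d : R) :
  `|a - b| <= d -> `|b| <= c -> `|a| <= c + d.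
Proof.
move=> ab bc; rewrite -(subrK b a) (le_trans (ler_normD _ _))// addrC.
exact: lerD.
Qed.

Lemma dist_perturb (V : normedModType R) (a a0 b b0 : V) (r p q : R) :
  `|a0 - b0| <= r -> `|a - a0| <= p -> `|b - b0| <= q -> `|a - b| <= r + p + q.
Proof.
move=> ab0 aa bb; have -> : a - b = (a0 - b0) + (a - a0) - (b - b0).
  by rewrite opprB [a0 - b0 + _]addrC !subrKA.
apply: le_trans (ler_normB _ _) (lerD _ bb).
exact: le_trans (ler_normD _ _) (lerD ab0 aa).
Qed.

(** For x close to x0, the representatives of h o g at x are those of h at g x
    composed with those of g; closeness of h to f0 over the image by g of a
    compact neighbourhood of x0 therefore gives closeness of h o g to f0 o g,
    up to a bound C of the differential of g, and closeness to f follows as the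
    inequalities satisfied by f0 o g at x0 are strict. *)
Lemma C1_nbhd_comp (g f0 f : Gspace M) i j K (e : R) x0 :
  compact K -> K `<=` dom i -> K `<=` sval f @^-1` dom j ->
  C1_nbhd f i j K e (Gmul g f0) -> K x0 ->
  exists V N, [/\ nbhs x0 V, nbhs f0 N &
    forall x h, V x -> K x -> N h ->
    C1_close_at f (Gmul g h) i j e x].
Proof.
move=> cK Ki Kj Nf0 Kx0.
have gS : smooth_map (sval g) := (svalP g).1.1.1.
have fS : smooth_map (sval f) := (svalP f).1.1.1.
have f0S : smooth_map (sval f0) := (svalP f0).1.1.1.
have f0gS := smooth_map_comp f0S gS.
have ix0 := Ki _ Kx0; have jx0 := Kj _ Kx0.
have [jgx0 val0 [e' e'e der0]] := Nf0 _ Kx0.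
have [k kx0] := atlas_cover (sval g x0).
pose m := Num.max e' `|loc j (sval f0 (sval g x0)) - loc j (sval f x0)|.
(* One third of the gap for each of f0 o g, f and h o g when x moves off x0. *)
pose eps := (e - m) / 3.
have me : m < e by rewrite /m gt_max e'e val0.
have eps0 : 0 < eps by rewrite divr_gt0// subr_gt0.
have [c c0 Gc] := linear_lipschitz (diff_continuous (rep_differentiable gS ix0 kx0)).
pose C := c + 1.
have C0 : 0 < C by rewrite addr_gt0.
have nG := diff_rep_near ltr01 gS ix0 kx0.
have nA := diff_rep_near eps0 f0gS ix0 jgx0.
have nB := diff_rep_near eps0 fS ix0 jx0.
have nk : \forall x \near x0, dom k (sval g x).
  by apply: (gS.1 x0); apply: open_nbhs_nbhs; split=> //; exact: dom_open.
have nval : \forall x \near x0,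
    `|loc j (sval f0 (sval g x)) - loc j (sval f x)| <= m + eps.
  have vc : {for x0, continuous (fun x => `|loc j (sval f0 (sval g x)) - loc j (sval f x)|)}.
    apply: (@continuous_comp _ _ _
      (fun x => loc j (sval f0 (sval g x)) - loc j (sval f x)) (fun v => `|v|));
      last exact: norm_continuous.
    apply: continuousB.
      apply: (@continuous_comp _ _ _ (sval f0 \o sval g) (loc j)); first exact: f0gS.1.
      exact: loc_continuous.
    apply: (@continuous_comp _ _ _ (sval f) (loc j)); first exact: fS.1.
    exact: loc_continuous.
  move/cvgrPdist_le : vc => /(_ _ eps0); apply: filterS => x.
  rewrite ler_distlC => /andP[_] /le_trans; apply; rewrite lerD2r.
  by rewrite /m le_max lexx orbT.
have [W nW cW] : exists2 W, nbhs x0 W & closure W `<=` [set x | [/\ dom k (sval g x),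
    `|loc j (sval f0 (sval g x)) - loc j (sval f x)| <= m + eps,
    forall v : 'rV[R]_(n.*2.+1), `|v| <= 1 -> `|'d (loc k \o sval g \o par i) (loc i x) v -
      'd (loc k \o sval g \o par i) (loc i x0) v| <= 1,
    forall v : 'rV[R]_(n.*2.+1), `|v| <= 1 ->
      `|'d (loc j \o (sval f0 \o sval g) \o par i) (loc i x) v -
      'd (loc j \o (sval f0 \o sval g) \o par i) (loc i x0) v| <= eps &
    forall v : 'rV[R]_(n.*2.+1), `|v| <= 1 -> `|'d (loc j \o sval f \o par i) (loc i x) v -
      'd (loc j \o sval f \o par i) (loc i x0) v| <= eps]].
  have reg := compact_regular (@manifold_hausdorff _ _ M) (@contact_compact _ _ M)
    (@filterT _ (nbhs x0) _).
  apply: reg.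
  have FI := @filterI _ _ (nbhs_filter x0).
  have nall := FI _ _ nk (FI _ _ nval (FI _ _ nG (FI _ _ nA nB))).
  apply: (@filterS _ (nbhs x0) (nbhs_filter x0) _ _ _ nall).
  by move=> x [h1 [h2 [h3 [h4 h5]]]]; exact: And5 h1 h2 h3 h4 h5.
pose K1 := sval g @` (K `&` closure W).
have cK1 : compact K1.
  apply: continuous_compact; first exact/continuous_subspaceT/gS.1.
  by apply: compact_closedI => //; exact: closed_closure.
have K1k : K1 `<=` dom k by move=> _ [x [_ /cW[kx _ _ _ _]] <-].
have K1j : K1 `<=` sval f0 @^-1` dom j.
  by move=> _ [x [Kx _] <-]; have [] := Nf0 _ Kx.
have epsC : 0 < eps / C by rewrite divr_gt0.
exists W, (C1_nbhd f0 k j K1 (eps / C)); split=> //.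
  apply: open_nbhs_nbhs; split.
    apply: C1_subbase_open.
    by exists f0, k, j, K1, (eps / C); split.
  move=> y K1y; split; first exact: K1j.
    by rewrite subrr normr0.
  by exists 0 => // v _; rewrite subrr normr0.
move=> x h Wx Kx Nh.
have cWx : closure W x by exact: subset_closure.
have [kx valx Gx Ax Bx] := cW _ cWx.
have [|jhx valh [e1 e1e derh]] := Nh (sval g x); first by exists x.
have hS : smooth_map (sval h) := (svalP h).1.1.1.
have [jx _ _] := Nf0 _ Kx.
have C1 : 1 <= C by rewrite lerDr ltW.
have epsCe : eps / C <= eps by rewrite ler_pdivrMr// ler_pMr.
split=> //.
  apply: le_lt_trans (ler_distD (loc j (sval f0 (sval g x))) _ _) _.
  apply: lt_le_trans (ltr_leD valh valx) _.
  have := epsCe; rewrite /eps; lra.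
have e'm : e' <= m by rewrite /m le_max lexx.
exists (C * e1 + (e' + eps + eps)).
  have : C * e1 < eps by rewrite mulrC -ltr_pdivlMr.
  rewrite /eps; lra.
move=> v v1.
apply: (composed_dist C0 derh _ (diff_rep_comp hS gS (Ki _ Kx) kx jhx v)
   (diff_rep_comp f0S gS (Ki _ Kx) kx jx v)).
  apply: norm_dist_le (Gx v v1) _; apply: le_trans (Gc v) _.
  by rewrite ler_piMr// ltW.
exact: dist_perturb (der0 v v1) (Ax v v1) (Bx v v1).
Qed.

Lemma Gmul_continuous (g : Gspace M) : continuous (Gmul g).
Proof.
move=> f0; apply: nbhs_subbase Gspace_openP _ => N.
move=> [f [i [j [K [e [cK Ki Kj e0 ->]]]]]] Nf0.
have cov := (near_covering_withinP K).2 ((compact_near_coveringP K).1 cK).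
apply: (cov _ (nbhs f0) (fun h => C1_close_at f (Gmul g h) i j e)) => x0 Kx0.
have [V [N' [nV nN' VN']]] := C1_nbhd_comp cK Ki Kj Nf0 Kx0.
by exists (V, N') => // -[x h] [/= Vx N'h] Kx; exact: VN'.
Qed.

End C1_topology.

(** * Homotopies and concatenation of paths *)

Section continuity_on_intervals.
Context {R : realType}.

Lemma continuous_paste (X T : topologicalType) (u : X -> R) (c : R) (f g : X -> T) :
  continuous u -> continuous f -> continuous g ->
  (forall x, u x = c -> f x = g x) ->
  continuous (fun x => if u x <= c then f x else g x).
Proof.
move=> uc fc gc fg; apply/continuous_subspace_setT.
have -> : setT = u @^-1` [set y | y <= c] `|` u @^-1` [set y | c <= y].
  by apply/seteqP; split=> x //= _; have [|/ltW] := leP (u x) c; [left|right].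
apply: withinU_continuous.
- by apply: closed_comp => [x _|]; [exact: uc|exact: closed_le].
- by apply: closed_comp => [x _|]; [exact: uc|exact: closed_ge].
- apply: (@subspace_eq_continuous _ _ _ (f : subspace _ -> T)) (continuous_subspaceT fc).
  by move=> x /set_mem ux; rewrite /from_subspace/= ifT.
- apply: (@subspace_eq_continuous _ _ _ (g : subspace _ -> T)) (continuous_subspaceT gc).
  move=> x /set_mem cu; rewrite /from_subspace/=; case: ifPn => // uc'; rewrite -fg//.
  by apply/eqP; rewrite eq_le uc' cu.
Qed.

Definition clamp (t : R) : R := Num.max 0 (Num.min 1 t).

Lemma continuous_minr (a b : R -> R) : continuous a -> continuous b ->
  continuous (fun t => Num.min (a t) (b t)).
Proof. by move=> ac bc t; apply: continuous_min; [exact: ac|exact: bc]. Qed.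

Lemma continuous_maxr (a b : R -> R) : continuous a -> continuous b ->
  continuous (fun t => Num.max (a t) (b t)).
Proof. by move=> ac bc t; apply: continuous_max; [exact: ac|exact: bc]. Qed.

Lemma clamp_continuous : continuous clamp.
Proof.
apply: continuous_maxr; first by move=> t; exact: cvg_cst.
by apply: continuous_minr => t; [exact: cvg_cst|exact: cvg_id].
Qed.

Lemma clamp_itv t : clamp t \in `[0, 1].
Proof. by rewrite in_itv/= le_max lexx ge_max ler01 ge_min lexx. Qed.

Lemma clampE t : t \in `[0, 1] -> clamp t = t.
Proof.
by rewrite in_itv/= => /andP[t0 t1]; rewrite /clamp (min_r t1) (max_r t0).
Qed.

Lemma affine_continuous (a b : R) : continuous (fun t : R => a * t + b).
Proof.
move=> t; apply: continuousD; last exact: cvg_cst.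
by apply: continuousM; [exact: cvg_cst|exact: cvg_id].
Qed.

Lemma continuous_plug (X T : topologicalType) (H : R * R -> T) (a b : X -> R) :
  continuous H -> continuous a -> continuous b -> continuous (fun x => H (a x, b x)).
Proof.
move=> Hc ac bc x; apply: (@continuous_comp _ _ _ (fun x => (a x, b x)) H); last exact: Hc.
by apply: pair_continuous; [exact: ac|exact: bc].
Qed.

Lemma continuous_comp_fst (f : R -> R) :
  continuous f -> continuous (fun p : R * R => f p.1).
Proof.
by move=> fc p; apply: (@continuous_comp _ _ _ fst f); [exact: fst_continuous|exact: fc].
Qed.

Lemma continuous_comp_snd (f : R -> R) :
  continuous f -> continuous (fun p : R * R => f p.2).
Proof.
by move=> fc p; apply: (@continuous_comp _ _ _ snd f); [exact: snd_continuous|exact: fc].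
Qed.

End continuity_on_intervals.

Section path_algebra.
Context {R : realType} {n : nat} (M : closed_contact_manifold R n).
Implicit Types gamma delta eta : R -> Gspace M.

Lemma GpathP gamma : Gpath gamma <-> continuous (gamma \o clamp).
Proof.
split=> [gc|gc].
  apply/continuous_subspace_setT.
  apply: (@within_continuous_comp R R (Gspace M) setT `[0, 1] clamp gamma) => //.
    by move=> t _; exact: clamp_itv.
  exact/continuous_subspaceT/clamp_continuous.
apply: (@subspace_eq_continuous _ _ _ (gamma \o clamp : subspace _ -> _)) (continuous_subspaceT gc).
by move=> t /set_mem t01; rewrite /= clampE.
Qed.

Lemma in01_0 : (0 : R) \in `[0, 1].
Proof. by rewrite in_itv/= lexx ler01. Qed.

Lemma in01_1 : (1 : R) \in `[0, 1].
Proof. by rewrite in_itv/= lexx ler01. Qed.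

(** Extending by constants outside of the square, through [clamp], trades
    continuity on a subspace for continuity on the plane. *)
Lemma path_homotopicP gamma delta : path_homotopic gamma delta <->
  exists H : R * R -> Gspace M,
    [/\ continuous H, forall t, H (0, t) = gamma (clamp t),
        forall t, H (1, t) = delta (clamp t),
        forall s, H (s, 0) = gamma 0 & forall s, H (s, 1) = gamma 1].
Proof.
split=> [[h [hc h0 h1 hs0 hs1]]|[H [Hc H0 H1 Hs0 Hs1]]]; last first.
  exists H; split=> //; first exact: continuous_subspaceT.
    by move=> t t01; rewrite H0 clampE.
  by move=> t t01; rewrite H1 clampE.
exists (fun p => h (clamp p.1, clamp p.2)); split=> /=.
- apply/continuous_subspace_setT.
  apply: (@within_continuous_comp (R * R)%type (R * R)%type (Gspace M) setT
    (`[0, 1] `*` `[0, 1]) (fun p => (clamp p.1, clamp p.2)) h) => //.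
    by move=> p _; split; exact: clamp_itv.
  apply: continuous_subspaceT; apply: (@continuous_plug _ _ _ id).
  - by move=> p; exact: cvg_id.
  - exact/continuous_comp_fst/clamp_continuous.
  - exact/continuous_comp_snd/clamp_continuous.
- by move=> t; rewrite (clampE in01_0) h0//; exact: clamp_itv.
- by move=> t; rewrite (clampE in01_1) h1//; exact: clamp_itv.
- by move=> s; rewrite (clampE in01_0) hs0//; exact: clamp_itv.
- by move=> s; rewrite (clampE in01_1) hs1//; exact: clamp_itv.
Qed.

Lemma eq_path_homotopic gamma gamma' delta delta' :
  (forall t, t \in `[0, 1] -> gamma t = gamma' t) ->
  (forall t, t \in `[0, 1] -> delta t = delta' t) ->
  path_homotopic gamma delta -> path_homotopic gamma' delta'.
Proof.
move=> gg dd [h [hc h0 h1 hs0 hs1]]; exists h; split=> //.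
- by move=> t t01; rewrite h0// gg.
- by move=> t t01; rewrite h1// dd.
- by move=> s s01; rewrite hs0// gg// in01_0.
- by move=> s s01; rewrite hs1// gg// in01_1.
Qed.

Lemma path_homotopic_ends gamma delta : path_homotopic gamma delta ->
  gamma 0 = delta 0 /\ gamma 1 = delta 1.
Proof.
by move=> [h [_ h0 h1 hs0 hs1]]; rewrite -!h1 ?in01_0 ?in01_1// hs0 ?hs1 ?in01_1.
Qed.

Lemma path_homotopic_Gpath gamma delta : path_homotopic gamma delta ->
  Gpath gamma /\ Gpath delta.
Proof.
move=> /path_homotopicP[H [Hc H0 H1 _ _]]; split; apply/GpathP.
  rewrite (_ : _ \o _ = H \o (fun t => (0, t))); last by apply/funext => t /=.
  move=> t; apply: continuous_comp; last exact: Hc.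
  by apply: pair_continuous; [exact: cvg_cst|exact: cvg_id].
rewrite (_ : _ \o _ = H \o (fun t => (1, t))); last by apply/funext => t /=.
move=> t; apply: continuous_comp; last exact: Hc.
by apply: pair_continuous; [exact: cvg_cst|exact: cvg_id].
Qed.

(** The parameter moves along the segment from [a t] to [b t]. The unit,
    inverse and associativity laws of concatenation below compare two
    reparametrizations of one path. *)
Lemma path_homotopic_reparam gamma (a b : R -> R) : Gpath gamma ->
  continuous a -> continuous b ->
  (forall t, t \in `[0, 1] -> a t \in `[0, 1] /\ b t \in `[0, 1]) ->
  a 0 = b 0 -> a 1 = b 1 -> path_homotopic (gamma \o a) (gamma \o b).
Proof.
move=> /GpathP gc ac bc ab ab0 ab1.
pose u (p : R * R) := a p.2 + p.1 * (b p.2 - a p.2).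
exists (fun p => (gamma \o clamp) (u p)); split.
- have a2 := continuous_comp_snd ac; have b2 := continuous_comp_snd bc.
  have uc : continuous u.
    move=> p; apply: (@continuousD _ _ _ (fun p : R * R => a p.2)
      (fun p : R * R => p.1 * (b p.2 - a p.2))); first exact: a2.
    apply: (@continuousM _ _ fst (fun p : R * R => b p.2 - a p.2)).
      exact: fst_continuous.
    apply: (@continuousB _ _ _ (fun p : R * R => b p.2) (fun p : R * R => a p.2)).
      exact: b2.
    exact: a2.
  apply: continuous_subspaceT => p.
  by apply: (@continuous_comp _ _ _ u (gamma \o clamp)); [exact: uc|exact: gc].
- move=> t t01; have [a01 _] := ab _ t01.
  by rewrite /u/= mul0r addr0 clampE.
- move=> t t01; have [_ b01] := ab _ t01.
  by rewrite /u/= mul1r addrC subrK clampE.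
- move=> s _; have [a01 _] := ab _ in01_0.
  by rewrite /u/= ab0 subrr mulr0 addr0 clampE// -ab0.
- move=> s _; have [a01 _] := ab _ in01_1.
  by rewrite /u/= ab1 subrr mulr0 addr0 clampE// -ab1.
Qed.

Lemma path_homotopic_refl gamma : Gpath gamma -> path_homotopic gamma gamma.
Proof.
by move=> gc; apply: (@path_homotopic_reparam gamma id id) => // t; exact: cvg_id.
Qed.

Lemma path_homotopic_sym gamma delta :
  path_homotopic gamma delta -> path_homotopic delta gamma.
Proof.
move=> /[dup]/path_homotopic_ends[g0 g1] /path_homotopicP[H [Hc H0 H1 Hs0 Hs1]].
apply/path_homotopicP; exists (fun p => H (- 1 * p.1 + 1, p.2)); split=> /=.
- apply: continuous_plug Hc _ _; last exact: snd_continuous.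
  exact: (continuous_comp_fst (@affine_continuous R (- 1) 1)).
- by move=> t; rewrite mulr0 add0r H1.
- by move=> t; rewrite mulr1 addNr H0.
- by move=> s; rewrite Hs0.
- by move=> s; rewrite Hs1.
Qed.

Lemma path_homotopic_trans gamma delta eta : path_homotopic gamma delta ->
  path_homotopic delta eta -> path_homotopic gamma eta.
Proof.
move=> /[dup]/path_homotopic_ends[g0 g1] /path_homotopicP[H [Hc H0 H1 Hs0 Hs1]].
move=> /path_homotopicP[K [Kc K0 K1 Ks0 Ks1]]; apply/path_homotopicP.
exists (fun p => if p.1 <= 2^-1 then H (2 * p.1 + 0, p.2) else K (2 * p.1 + (- 1), p.2)).
split=> /=.
- apply: (@continuous_paste _ _ _ fst 2^-1 (fun p => H (2 * p.1 + 0, p.2))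
    (fun p => K (2 * p.1 + (- 1), p.2))).
  + exact: fst_continuous.
  + apply: continuous_plug Hc _ _; last exact: snd_continuous.
    exact: (continuous_comp_fst (@affine_continuous R 2 0)).
  + apply: continuous_plug Kc _ _; last exact: snd_continuous.
    exact: (continuous_comp_fst (@affine_continuous R 2 (- 1))).
  + by move=> [s t] /= ->; rewrite divff// addr0 subrr H1 K0.
- by move=> t; rewrite ifT ?mulr0 ?addr0 ?H0//; lra.
- move=> t; rewrite ifF; last by apply/negbTE; rewrite -ltNge; lra.
  by rewrite mulr1 [2 - 1](_ : _ = 1) ?K1//; lra.
- by move=> s; case: ifP => _; rewrite ?Hs0// Ks0 g0.
- by move=> s; case: ifP => _; rewrite ?Hs1// Ks1 g1.
Qed.

Lemma path_homotopic_comp (F : Gspace M -> Gspace M) gamma delta :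
  continuous F -> path_homotopic gamma delta ->
  path_homotopic (F \o gamma) (F \o delta).
Proof.
move=> Fc /path_homotopicP[H [Hc H0 H1 Hs0 Hs1]]; apply/path_homotopicP.
exists (F \o H); split=> /=.
- by move=> p; apply: continuous_comp; [exact: Hc|exact: Fc].
- by move=> t; rewrite H0.
- by move=> t; rewrite H1.
- by move=> s; rewrite Hs0.
- by move=> s; rewrite Hs1.
Qed.

Lemma path_concat0 gamma delta : path_concat gamma delta 0 = gamma 0.
Proof. by rewrite /path_concat ifT ?mulr0//; lra. Qed.

Lemma path_concat1 gamma delta : path_concat gamma delta 1 = delta 1.
Proof.
rewrite /path_concat ifF; last by apply/negbTE; rewrite -ltNge; lra.
by congr delta; lra.
Qed.

Lemma path_homotopic_concat gamma gamma' delta delta' : gamma 1 = delta 0 ->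
  path_homotopic gamma gamma' -> path_homotopic delta delta' ->
  path_homotopic (path_concat gamma delta) (path_concat gamma' delta').
Proof.
move=> gd /path_homotopicP[H [Hc H0 H1 Hs0 Hs1]].
move=> /path_homotopicP[K [Kc K0 K1 Ks0 Ks1]].
exists (fun p => if p.2 <= 2^-1 then H (p.1, 2 * p.2 + 0) else K (p.1, 2 * p.2 + (- 1))).
have in1 (t : R) : t \in `[0, 1] -> t <= 2^-1 -> 2 * t + 0 \in `[0, 1].
  by rewrite !in_itv/= => /andP[t0 t1] t2; lra.
have in2 (t : R) : t \in `[0, 1] -> 2^-1 < t -> 2 * t + (- 1) \in `[0, 1].
  by rewrite !in_itv/= => /andP[t0 t1] t2; lra.
split.
- apply: continuous_subspaceT.
  apply: (@continuous_paste _ _ _ snd 2^-1 (fun p => H (p.1, 2 * p.2 + 0))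
    (fun p => K (p.1, 2 * p.2 + (- 1)))).
  + exact: snd_continuous.
  + apply: continuous_plug Hc _ _; first exact: fst_continuous.
    exact: (continuous_comp_snd (@affine_continuous R 2 0)).
  + apply: continuous_plug Kc _ _; first exact: fst_continuous.
    exact: (continuous_comp_snd (@affine_continuous R 2 (- 1))).
  + by move=> [s t] /= ->; rewrite divff// addr0 subrr Hs1 Ks0.
- move=> t t01; rewrite /path_concat/=; have [t2|t2] := leP t 2^-1.
    by rewrite H0 clampE ?addr0//; have := in1 _ t01 t2; rewrite addr0.
  by rewrite K0 clampE//; exact: in2.
- move=> t t01; rewrite /path_concat/=; have [t2|t2] := leP t 2^-1.
    by rewrite H1 clampE ?addr0//; have := in1 _ t01 t2; rewrite addr0.
  by rewrite K1 clampE//; exact: in2.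
- move=> s _ /=; rewrite path_concat0 ifT; last by lra.
  by rewrite mulr0 addr0 Hs0.
- move=> s _ /=; rewrite path_concat1 ifF; last by apply/negbTE; rewrite -ltNge; lra.
  by rewrite (_ : 2 * 1 + - 1 = 1) ?Ks1//; lra.
Qed.

Lemma Gpath_concat gamma delta : gamma 1 = delta 0 -> Gpath gamma -> Gpath delta ->
  Gpath (path_concat gamma delta).
Proof.
move=> gd /path_homotopic_refl gg /path_homotopic_refl dd.
by have [] := path_homotopic_Gpath (path_homotopic_concat gd gg dd).
Qed.

Definition path_rev gamma (t : R) : Gspace M := gamma (- 1 * t + 1).

Lemma Gpath_cst (x : Gspace M) : Gpath (fun=> x).
Proof. by apply: continuous_subspaceT => t; exact: cvg_cst. Qed.

Lemma in01_rev (t : R) : t \in `[0, 1] -> - 1 * t + 1 \in `[0, 1].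
Proof. by rewrite !in_itv/=; lra. Qed.

Lemma Gpath_rev gamma : Gpath gamma -> Gpath (path_rev gamma).
Proof.
apply: (@within_continuous_comp R R (Gspace M) `[0, 1] `[0, 1] (fun t => - 1 * t + 1) gamma).
  exact: in01_rev.
exact/continuous_subspaceT/affine_continuous.
Qed.

Lemma path_concat_cst gamma : Gpath gamma ->
  path_homotopic (path_concat gamma (fun=> gamma 1)) gamma.
Proof.
move=> gc; apply: (@eq_path_homotopic
  (gamma \o fun t => Num.min (2 * t + 0) 1) _ (gamma \o id)).
- move=> t t01; rewrite /path_concat/=; have [t2|t2] := leP t 2^-1.
    by congr gamma; rewrite min_l; lra.
  by congr gamma; rewrite min_r; lra.
- by [].
apply: path_homotopic_reparam => //.
- apply: continuous_minr; first exact: affine_continuous.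
  by move=> t; exact: cvg_cst.
- by move=> t; exact: cvg_id.
- move=> t t01; split=> //; move: t01; rewrite !in_itv/= => /andP[t0 t1].
  by rewrite le_min ge_min lexx orbT andbT; lra.
- by rewrite min_l; lra.
- by rewrite min_r; lra.
Qed.

Lemma cst_path_concat gamma : Gpath gamma ->
  path_homotopic (path_concat (fun=> gamma 0) gamma) gamma.
Proof.
move=> gc; apply: (@eq_path_homotopic
  (gamma \o fun t => Num.max (2 * t + (- 1)) 0) _ (gamma \o id)).
- move=> t t01; rewrite /path_concat/=; have [t2|t2] := leP t 2^-1.
    by congr gamma; rewrite max_r; lra.
  by congr gamma; rewrite max_l; lra.
- by [].
apply: path_homotopic_reparam => //.
- apply: continuous_maxr; first exact: affine_continuous.
  by move=> t; exact: cvg_cst.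
- by move=> t; exact: cvg_id.
- move=> t t01; split=> //; move: t01; rewrite !in_itv/= => /andP[t0 t1].
  by rewrite le_max ge_max lexx orbT/=; lra.
- by rewrite max_r; lra.
- by rewrite max_l; lra.
Qed.

Lemma path_concat_rev gamma : Gpath gamma ->
  path_homotopic (path_concat gamma (path_rev gamma)) (fun=> gamma 0).
Proof.
move=> gc; apply: (@eq_path_homotopic
  (gamma \o fun t => Num.min (2 * t + 0) (- 2 * t + 2)) _ (gamma \o fun=> 0)).
- move=> t t01; rewrite /path_concat/=; have [t2|t2] := leP t 2^-1.
    by congr gamma; rewrite min_l; lra.
  by rewrite /path_rev; congr gamma; rewrite min_r; lra.
- by [].
apply: path_homotopic_reparam => //.
- by apply: continuous_minr; exact: affine_continuous.
- by move=> t; exact: cvg_cst.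
- move=> t t01; split=> //; last exact: in01_0.
  move: t01; rewrite !in_itv/= => /andP[t0 t1].
  have [h|h] := leP (2 * t + 0) (- 2 * t + 2); lra.
- by rewrite min_l; lra.
- by rewrite min_r; lra.
Qed.

Lemma path_revK gamma : path_rev (path_rev gamma) = gamma.
Proof. by apply/funext => t; rewrite /path_rev; congr gamma; lra. Qed.

Lemma path_rev_concat gamma : Gpath gamma ->
  path_homotopic (path_concat (path_rev gamma) gamma) (fun=> gamma 1).
Proof.
move=> gc; have := path_concat_rev (Gpath_rev gc); rewrite path_revK.
by rewrite /path_rev mulr0 add0r.
Qed.

(** The reparametrization a has slopes 2, 1 and 1/2 on the three pieces; it is
    concave, hence the minimum. *)
Lemma path_concatA gamma delta eta : Gpath gamma -> Gpath delta -> Gpath eta ->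
  gamma 1 = delta 0 -> delta 1 = eta 0 ->
  path_homotopic (path_concat gamma (path_concat delta eta))
                 (path_concat (path_concat gamma delta) eta).
Proof.
move=> gc dc ec gd de.
set P := path_concat gamma (path_concat delta eta).
pose a (t : R) := Num.min (Num.min (2 * t + 0) (1 * t + 4^-1)) (2^-1 * t + 2^-1).
have Pc : Gpath P.
  by apply: Gpath_concat => //; [rewrite path_concat0|exact: Gpath_concat].
apply: (@eq_path_homotopic (P \o id) _ (P \o a)) => // [t t01|].
  move: t01; rewrite in_itv/= => /andP[t0 t1].
  have [t2|t2] := leP t 2^-1; last first.
    have -> : a t = 2^-1 * t + 2^-1 by rewrite /a !min_r//; lra.
    rewrite /P /path_concat ifF; last by apply/negbTE; rewrite -ltNge; lra.
    rewrite ifF; last by apply/negbTE; rewrite -ltNge; lra.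
    rewrite [RHS]ifF; last by apply/negbTE; rewrite -ltNge; lra.
    by congr eta; lra.
  have [t4|t4] := leP t 4^-1.
    have -> : a t = 2 * t.
      by rewrite /a [X in Num.min X _]min_l ?min_l; lra.
    rewrite /P /path_concat ifT; last by lra.
    by rewrite [RHS]ifT// ifT//; lra.
  have -> : a t = t + 4^-1.
    by rewrite /a [X in Num.min X _]min_r ?min_l; lra.
  rewrite /P /path_concat ifF; last by apply/negbTE; rewrite -ltNge; lra.
  rewrite ifT; last by lra.
  rewrite [RHS]ifT// [RHS]ifF; last by apply/negbTE; rewrite -ltNge; lra.
  by congr delta; lra.
apply: path_homotopic_reparam => //.
- by move=> t; exact: cvg_id.
- by do ?apply: continuous_minr; exact: affine_continuous.
- move=> t t01; split=> //; move: t01; rewrite !in_itv/= => /andP[t0 t1].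
  by rewrite /a !le_min !ge_min; lra.
- by rewrite /a [X in Num.min X _]min_l ?min_l; lra.
- by rewrite /a !min_r; lra.
Qed.

Lemma path_concat_revK gamma delta : Gpath gamma -> Gpath delta ->
  gamma 0 = delta 0 ->
  path_homotopic (path_concat gamma (path_concat (path_rev gamma) delta)) delta.
Proof.
move=> gc dc gd; have rc := Gpath_rev gc.
have r0 : gamma 1 = path_rev gamma 0 by rewrite /path_rev mulr0 add0r.
have r1 : path_rev gamma 1 = delta 0 by rewrite /path_rev mulr1 addNr.
apply: path_homotopic_trans (path_concatA gc rc dc r0 r1) _.
have E := path_homotopic_concat _ (path_concat_rev gc) (path_homotopic_refl dc).
apply: path_homotopic_trans (E _) _; first by rewrite path_concat1.
by rewrite gd; exact: cst_path_concat.
Qed.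

End path_algebra.

(** * Right translations of the universal cover *)

Section cover_translation.
Context {R : realType} {n : nat} (M : closed_contact_manifold R n).
Implicit Types (gamma delta eta : R -> Gspace M) (C : Gcover M).

Lemma Gcover_openP (U : set (Gcover M)) : open U ->
  exists2 D, D `<=` finI_from (@cover_base R n M) id & \bigcup_(i in D) i = U.
Proof. by move=> [D sD <-]; exists D. Qed.

Lemma cover_base_open (U : set (Gcover M)) : cover_base U -> open U.
Proof.
move=> bU; exists [set U]; last by rewrite bigcup_set1.
move=> _ ->; exists [fset U]%fset; first by move=> V /fset1P ->; exact/mem_set.
by rewrite set_fset1 bigcap_set1.
Qed.

Definition cover_rep C : R -> Gspace M := projT1 (cid (svalP C)).

Lemma cover_repP C : [/\ Gpath (cover_rep C), cover_rep C 0 = idG M &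
  sval C = path_class (cover_rep C)].
Proof. exact: (projT2 (cid (svalP C))). Qed.

Lemma path_class_eq gamma delta :
  path_homotopic gamma delta -> path_class gamma = path_class delta.
Proof.
move=> gd; apply/seteqP; split=> eta; last exact: path_homotopic_trans.
exact: path_homotopic_trans (path_homotopic_sym gd).
Qed.

Lemma Gcover_eq C C' : path_homotopic (cover_rep C) (cover_rep C') -> C = C'.
Proof.
have [_ _ E] := cover_repP C; have [_ _ E'] := cover_repP C'.
move=> /path_class_eq; rewrite -E -E'.
by case: C C' {E E'} => [C PC] [C' PC'] /= CC'; exact: eq_exist.
Qed.

Section translation.
Variables (gamma : R -> Gspace M) (g : Gspace M).
Hypotheses (gammaP : Gpath gamma) (gamma0 : gamma 0 = idG M)
  (gamma1 : Gmul g (gamma 1) = idG M).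

(** In the universal cover, timewise multiplication is homotopic to
    concatenation. The product of the class of delta with the inverse of the
    class of gamma is thus represented by the path which goes back along gamma
    and then along delta, translated by the inverse g of the end of gamma. This
    representative only involves right multiplication by a fixed element. *)
Definition translate_path delta : R -> Gspace M :=
  Gmul g \o path_concat (path_rev gamma) delta.

Lemma path_rev0 delta : path_rev delta 0 = delta 1.
Proof. by rewrite /path_rev mulr0 add0r. Qed.

Lemma path_rev1 delta : path_rev delta 1 = delta 0.
Proof. by rewrite /path_rev mulr1 addNr. Qed.

Lemma translate_path_homotopic delta eta : delta 0 = idG M ->
  path_homotopic delta eta ->
  path_homotopic (translate_path delta) (translate_path eta).
Proof.
move=> d0 de; apply: path_homotopic_comp; first exact: Gmul_continuous.
apply: path_homotopic_concat => //; first by rewrite path_rev1 gamma0 d0.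
exact/path_homotopic_refl/Gpath_rev.
Qed.

Lemma Gpath_translate delta : Gpath delta -> delta 0 = idG M ->
  Gpath (translate_path delta).
Proof.
move=> dP d0; have := translate_path_homotopic d0 (path_homotopic_refl dP).
by move=> /path_homotopic_Gpath[].
Qed.

Lemma translate_path0 delta : translate_path delta 0 = idG M.
Proof. by rewrite /translate_path /= path_concat0 path_rev0. Qed.

Lemma translate_path1 delta : translate_path delta 1 = Gmul g (delta 1).
Proof. by rewrite /translate_path /= path_concat1. Qed.

Lemma translate_subproof C : exists delta, [/\ Gpath delta, delta 0 = idG M &
  path_class (translate_path (cover_rep C)) = path_class delta].
Proof.
have [cP c0 _] := cover_repP C; exists (translate_path (cover_rep C)); split=> //.
  exact: Gpath_translate.
exact: translate_path0.
Qed.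

Definition translate C : Gcover M := exist _ _ (translate_subproof C).

Lemma translate_rep C delta : sval C delta ->
  sval (translate C) (translate_path delta).
Proof.
have [_ c0 ->] := cover_repP C => cd.
exact: translate_path_homotopic.
Qed.

Lemma cover_rep_translate C :
  path_homotopic (cover_rep (translate C)) (translate_path (cover_rep C)).
Proof.
have [_ _ tE] := cover_repP (translate C); have [cP c0 cE] := cover_repP C.
suff : sval (translate C) (translate_path (cover_rep C)) by rewrite tE.
by apply: translate_rep; rewrite cE; exact: path_homotopic_refl.
Qed.

Lemma cover_proj_translate C : cover_proj (translate C) = Gmul g (cover_proj C).
Proof.
have [_] := path_homotopic_ends (cover_rep_translate C).
by rewrite translate_path1.
Qed.

Lemma translate_id C : path_homotopic (cover_rep C) gamma ->
  translate C = idGcover M.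
Proof.
move=> cg; apply: Gcover_eq; apply: path_homotopic_trans (cover_rep_translate C) _.
have [cP c0 cE] := cover_repP C.
apply: path_homotopic_trans (translate_path_homotopic c0 cg) _.
have tc := path_homotopic_comp (@Gmul_continuous _ _ _ g) (path_rev_concat gammaP).
apply: path_homotopic_trans tc _; apply: path_homotopic_sym.
have [iP i0 iE] := cover_repP (idGcover M).
have : sval (idGcover M) (fun=> idG M) by apply: path_homotopic_refl; exact: Gpath_cst.
by rewrite iE; apply: eq_path_homotopic.
Qed.

Lemma translate_inj (f : Gspace M) : cancel (sval f) (sval g) ->
  injective translate.
Proof.
move=> fgK C C' CC'; apply: Gcover_eq.
have [cP c0 _] := cover_repP C; have [c'P c'0 _] := cover_repP C'.
have := cover_rep_translate C'; rewrite -CC' => h'.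
have h := path_homotopic_trans (path_homotopic_sym (cover_rep_translate C)) h'.
have := path_homotopic_comp (@Gmul_continuous _ _ _ f) h.
have fg delta : Gmul f \o translate_path delta = path_concat (path_rev gamma) delta.
  by apply/funext => t; exact: GmulK.
rewrite !fg => {}h.
have gg := path_homotopic_refl gammaP.
have E : gamma 1 = path_concat (path_rev gamma) (cover_rep C) 0.
  by rewrite path_concat0 path_rev0.
have {}h := path_homotopic_concat E gg h.
have k := path_concat_revK gammaP cP (etrans gamma0 (esym c0)).
have k' := path_concat_revK gammaP c'P (etrans gamma0 (esym c'0)).
exact: path_homotopic_trans (path_homotopic_sym k) (path_homotopic_trans h k').
Qed.

(** If the image of C lies in the basic set of the prolongations of gamma' inside
    U, prolonging C inside the preimage of U prolongs its image inside U; so a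
    basic neighbourhood of C is mapped into the given basic set. *)
Lemma translate_continuous : continuous translate.
Proof.
move=> C; apply: nbhs_subbase Gcover_openP _ => _ [gamma' [U [g'P g'0 oU ->]]].
move=> [eta [etaP eta0 etaU Teta]].
have [cP c0 cE] := cover_repP C.
pose V := Gmul g @^-1` U.
have oV : open V.
  by apply: open_comp oU => x _; exact: Gmul_continuous.
have cTeta : path_homotopic (translate_path (cover_rep C)) (path_concat gamma' eta).
  exact: Teta.
have Vend : V (cover_rep C 1).
  rewrite /V/=; have [_] := path_homotopic_ends cTeta.
  by rewrite translate_path1 path_concat1 => ->; apply: etaU; exact: in01_1.
pose B := [set C' : Gcover M | exists eta', [/\ Gpath eta', eta' 0 = cover_rep C 1,
  forall t, t \in `[0, 1] -> V (eta' t) & sval C' (path_concat (cover_rep C) eta')]].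
have nB : nbhs C B.
  apply: open_nbhs_nbhs; split; first by apply: cover_base_open; exists (cover_rep C), V.
  exists (fun=> cover_rep C 1); split=> //; first exact: Gpath_cst.
  by rewrite cE; exact/path_homotopic_sym/path_concat_cst.
apply: filterS nB => C' [eta' [eta'P eta'0 eta'V C'eta']].
have ends : eta 1 = (Gmul g \o eta') 0.
  have [_] := path_homotopic_ends cTeta.
  by rewrite translate_path1 path_concat1 /= eta'0.
have geta'P : Gpath (Gmul g \o eta').
  have := path_homotopic_comp (@Gmul_continuous _ _ _ g) (path_homotopic_refl eta'P).
  by move=> /path_homotopic_Gpath[].
exists (path_concat eta (Gmul g \o eta')); split.
- exact: Gpath_concat.
- by rewrite path_concat0.
- move=> t; rewrite in_itv/= => /andP[t0 t1]; rewrite /path_concat.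
  have [t2|t2] := leP t 2^-1; first by apply: etaU; rewrite in_itv/=; lra.
  by apply: eta'V; rewrite in_itv/=; lra.
have := translate_rep C'eta'; have [_ _ ->] := cover_repP (translate C') => h.
apply: path_homotopic_trans h _; apply: path_homotopic_sym.
apply: path_homotopic_trans (path_concatA g'P etaP geta'P (esym eta0) ends) _.
have r1 : path_rev gamma 1 = cover_rep C 0 by rewrite path_rev1 gamma0 c0.
have rA := path_concatA (Gpath_rev gammaP) cP eta'P r1 (esym eta'0).
have {}rA := path_homotopic_comp (@Gmul_continuous _ _ _ g) (path_homotopic_sym rA).
apply: path_homotopic_trans _ rA.
have -> : Gmul g \o path_concat (path_concat (path_rev gamma) (cover_rep C)) eta' =
    path_concat (translate_path (cover_rep C)) (Gmul g \o eta').
  by apply/funext => t; rewrite /path_concat /=; case: ifP.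
apply: path_homotopic_concat; first by rewrite path_concat1.
  exact: path_homotopic_sym.
exact: path_homotopic_refl.
Qed.

Lemma Gcover_le_translate C C' : Gcover_le C C' ->
  Gcover_le (translate C) (translate C').
Proof.
move=> [z [[zc iso] z0 z1 pos]].
have E : @cover_proj _ _ M \o (translate \o z) = fun t => Gmul g (cover_proj (z t)).
  by apply/funext => t /=; rewrite cover_proj_translate.
exists (translate \o z); split; [split| | |].
- apply: (@within_continuous_comp R (Gcover M) (Gcover M) `[0, 1] setT z translate) => //.
  exact/continuous_subspaceT/translate_continuous.
- rewrite /Gisotopy E; exact: contact_isotopy_comp_right iso (svalP g).1.
- by rewrite /= z0.
- by rewrite /= z1.
- rewrite (_ : (fun t => _) = fun t => sval (cover_proj (z t)) \o sval g).
    exact: nonneg_hamiltonian_comp_right.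
  by apply/funext => t /=; rewrite cover_proj_translate.
Qed.

End translation.

Lemma Gcover_le_trans C1 C2 C3 :
  Gcover_le C1 C2 -> Gcover_le C2 C3 -> Gcover_le C1 C3.
Proof.
move=> [z1 [[zc1 iso1] z10 z11 pos1]] [z2 [[zc2 iso2] z20 z21 pos2]].
have [c1 [c2 [[cc1 cc2] [b1 b2] [c10 c11 c20 c21] cat]]] := contact_isotopy_concat M.
have E : z1 1 = z2 0 by rewrite z11 z20.
have [iso pos] := cat (Gcover M) (fun C => sval (cover_proj C)) z1 z2 E.
have clampc (z : R -> Gcover M) (c : R -> R) : {within `[0, 1], continuous z} ->
    continuous c -> (forall t, 0 <= c t <= 1) -> continuous (z \o c).
  move=> zc cc b; apply/continuous_subspace_setT.
  apply: (@within_continuous_comp R R (Gcover M) setT `[0, 1] c z) => //.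
    by move=> t _; rewrite /= in_itv/=; exact: b.
  exact: continuous_subspaceT.
eexists; split; [split| | |].
- apply: continuous_subspaceT.
  apply: (@continuous_paste _ _ _ id 2^-1 (z1 \o c1) (z2 \o c2)).
  + by move=> t; exact: cvg_id.
  + exact: clampc.
  + exact: clampc.
  + by move=> _ /= ->; rewrite c11 c20.
- exact: iso iso1 iso2.
- by rewrite /= ifT ?c10//; lra.
- by rewrite /= ifF ?c21//; apply/negbTE; rewrite -ltNge; lra.
- exact: pos pos1 pos2.
Qed.

End cover_translation.

(** * Orderability and monotone maps *)

Section orderability.
Context {R : realType} (T : Type) (le : T -> T -> Prop) (e : T).
Hypothesis le_trans : forall x y z, le x y -> le y z -> le x z.

(** The map is the indicator of the elements above e and different from e: by
    antisymmetry, no element above one of these can be equal to e. *)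
Lemma orderable_exists_map : orderable le ->
  exists c : T -> R, [/\ nondecreasing_map le c, c e = 0 &
    forall x, le e x -> x <> e -> 0 < c x].
Proof.
move=> ord; exists (fun x => (`[< le e x /\ x <> e >])%:R); split.
- move=> x y xy; have [[ex xe]|] := asboolP (le e x /\ x <> e); last by rewrite ler0n.
  rewrite (_ : `[< le e y /\ y <> e >] = true)//; apply/asboolP.
  split; first exact: le_trans xy.
  by move=> ye; apply: xe; apply: ord => //; rewrite -ye.
- by rewrite asboolF// => -[].
- by move=> x ex xe; rewrite asboolT.
Qed.

(** Translating x to e turns x <= y <= x into e <= f y <= e, where the map
    forces f y = e. *)
Lemma exists_map_orderable :
  (forall x, exists2 f : T -> T, injective f /\ f x = e &
     forall y z, le y z -> le (f y) (f z)) ->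
  (exists c : T -> R, [/\ nondecreasing_map le c, c e = 0 &
    forall x, le e x -> x <> e -> 0 < c x]) -> orderable le.
Proof.
move=> tr [c [cmono c0 cpos]] x y xy yx.
have [f [finj fx] fmono] := tr x.
apply: finj; rewrite fx; apply: contrapT => /nesym fye.
have := fmono _ _ xy; rewrite fx => /cpos/(_ fye).
have /cmono := fmono _ _ yx; rewrite fx c0 => h /lt_le_trans/(_ h).
by rewrite ltxx.
Qed.

End orderability.

Theorem corollary1p3 (R : realType) (n : nat) (M : closed_contact_manifold R n) :
  (orderable (@Gle R n M) <->
   exists c : Gspace M -> R,
     [/\ nondecreasing_map (@Gle R n M) c,
         c (idG M) = 0 &
         forall psi, Gle (idG M) psi -> psi <> idG M -> 0 < c psi]) /\
  (orderable (@Gcover_le R n M) <->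
   exists c : Gcover M -> R,
     [/\ nondecreasing_map (@Gcover_le R n M) c,
         c (idGcover M) = 0 &
         forall psi, Gcover_le (idGcover M) psi -> psi <> idGcover M ->
           0 < c psi]).
Proof.
split; split.
- exact: orderable_exists_map (@Gle_trans R n M).
- apply: exists_map_orderable => x; have [g [xg gx]] := Gspace_inv x.
  exists (Gmul g); last exact: Gle_mul.
  split; last by apply: Gspace_eq; apply/funext => y /=; rewrite gx.
  exact: can_inj (fun h => GmulK h xg).
- exact: orderable_exists_map (@Gcover_le_trans R n M).
- apply: exists_map_orderable => x; have [cP c0 cE] := cover_repP x.
  have [g [xg gx]] := Gspace_inv (cover_rep x 1).
  have g1 : Gmul g (cover_rep x 1) = idG M.
    by apply: Gspace_eq; apply/funext => y /=; rewrite gx.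
  exists (translate cP c0 g1); last exact: Gcover_le_translate.
  split; first exact: translate_inj xg.
  by apply: translate_id; exact: path_homotopic_refl.
Qed.
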